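(* Let $R$ be a commutative noetherian local ring with residue field $k$. Let $M$ be a finitely generated $R$-module, and let $n\ge 0$ be an integer. (1) Suppose that $M$ belongs to $\mathscr{A}_n(R)$. Take a minimal $n$-AB approximation $0\to Y_M\to X_M\to M\to 0$ of $M$. Then $\xi_n(M)$ coincides with the rank of the maximal free summand of $X_M$. (2) Suppose that $M$ belongs to $\mathscr{E}_n(R)$. Then the following conditions are equivalent: (i) The equality $\xi_n(M)=0$ holds. (ii) For every $R$-homomorphism $f:M\to Z$, where $Z$ is a finitely generated $R$-module of projective dimension at most $n$, one has $f\otimes_R k=0$. (3) Suppose that $M$ belongs to $\mathscr{H}_n(R)$. For any $n$-FPD hull $0\to M\to Y\to X\to 0$ of $M$, the equality $\xi_n(M)=\mu(Y)-\mu(X)$ holds.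
   Context: All modules are finitely generated; $\operatorname{mod}R$ is the category of finitely generated $R$-modules, and $\mu(-)$ is the minimal number of generators. A module of projective dimension at most $-1$ is the zero module. Stable Hom and syzygies: $\underline{\operatorname{Hom}}_R(X,Y)$ is the quotient of $\operatorname{Hom}_R(X,Y)$ by the submodule of homomorphisms that factor through a projective module. The stable category $\underline{\operatorname{mod}}R$ has the same objects as $\operatorname{mod}R$ and these morphism groups. The syzygy $\Omega M$ is the kernel of a surjection $P_0\to M$ with $P_0$ finitely generated projective; it is unique up to projective summands and defines a functor $\Omega:\underline{\operatorname{mod}}R\to\underline{\operatorname{mod}}R$; $\Omega^n$ is its $n$-fold iterate ($\Omega^0=\mathrm{id}$). The $n$-th approximated $\xi$-invariant is $$\xi_n(M)=\dim_k\operatorname{Ker}\big(\operatorname{Hom}_R(M,k)\xrightarrow{\pi}\underline{\operatorname{Hom}}_R(M,k)\xrightarrow{\Omega^n}\underline{\operatorname{Hom}}_R(\Omega^nM,\Omega^nk)\big),$$ where $\pi$ is the canonical surjection. An $n$-AB approximation of $M$ is an exact sequence $0\to Y\to X\to M\to 0$ in $\operatorname{mod}R$ with $\operatorname{pd}_RY\le n-1$ and $\operatorname{Ext}^i_R(X,R)=0$ for all $1\le i\le n$. An $n$-origin extension of $M$ is an exact sequence $0\to X\to M\oplus P\to Y\to 0$ in $\operatorname{mod}R$ with $P$ projective, $\operatorname{pd}_RY\le n$ and $\operatorname{Ext}^i_R(X,R)=0$ for all $1\le i\le n$. An $n$-FPD hull of $M$ is an exact sequence $0\to M\to Y\to X\to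 0$ in $\operatorname{mod}R$ with $\operatorname{pd}_RY\le n$ and $\operatorname{Ext}^i_R(X,R)=0$ for all $1\le i\le n+1$. The subcategories $\mathscr{A}_n(R)$, $\mathscr{E}_n(R)$, $\mathscr{H}_n(R)$ of $\operatorname{mod}R$ consist of the modules having an $n$-AB approximation, an $n$-origin extension, an $n$-FPD hull, respectively. An $n$-AB approximation $0\to Y\xrightarrow{i}X\xrightarrow{p}M\to 0$ is minimal if for any direct sum decomposition $X=X_0\oplus X_1$ with $X_0\subset\operatorname{Im}i$ one has $X_0=0$. *)

(* Defs.v *)
From HB Require Import structures.
From mathcomp Require Import all_boot all_order all_algebra.
From mathcomp Require Import boolp classical_sets.

Set Implicit Arguments.
Unset Strict Implicit.
Unset Printing Implicit Defensive.

Import GRing.Theory.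
Local Open Scope classical_set_scope.
Local Open Scope ring_scope.

Section Modules.
Variable R : comNzRingType.

Definition submodule (V : lmodType R) (A : set V) : Prop :=
  [/\ A 0, (forall x y, A x -> A y -> A (x + y))
    & (forall (a : R) x, A x -> A (a *: x))].

Definition spans (V : lmodType R) (n : nat) (e : 'I_n -> V) (A : set V) : Prop :=
  forall x, A x <-> exists c : 'I_n -> R, x = \sum_(i < n) c i *: e i.

Definition generated_by (V : lmodType R) (n : nat) : Prop :=
  exists e : 'I_n -> V, spans e setT.

Definition fingen (V : lmodType R) : Prop := exists n, generated_by V n.

Definition mu (V : lmodType R) : nat :=
  xget 0%N [set n | generated_by V n /\
                    forall m, generated_by V m -> (n <= m)%N].

Definition ideal (I : set R) : Prop := @submodule R^o I.

Definition noetherian : Prop :=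
  forall I : set R, ideal I -> exists n (e : 'I_n -> R), @spans R^o n e I.

Definition maximal_ideal (m : set R) : Prop :=
  [/\ ideal m, ~ m 1 & forall J, ideal J -> m `<=` J -> ~ J 1 -> J = m].

Definition local_ring : Prop := exists! m : set R, maximal_ideal m.

Definition injective_map (U V : lmodType R) (f : U -> V) : Prop :=
  forall x y, f x = f y -> x = y.

Definition surjective_map (U V : lmodType R) (f : U -> V) : Prop :=
  forall y, exists x, f x = y.

Definition exact_at (U V W : lmodType R) (f : U -> V) (g : V -> W) : Prop :=
  forall v, g v = 0 <-> exists u, f u = v.

Definition short_exact (U V W : lmodType R)
    (f : {linear U -> V}) (g : {linear V -> W}) : Prop :=
  [/\ injective_map f, exact_at f g & surjective_map g].

Definition zero_module (V : lmodType R) : Prop := forall x : V, x = 0.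

Definition projective (P : lmodType R) : Prop :=
  forall (A B : lmodType R) (q : {linear A -> B}) (f : {linear P -> B}),
    surjective_map q -> exists h : {linear P -> A}, forall x, q (h x) = f x.

Definition fg_projective (P : lmodType R) : Prop := fingen P /\ projective P.

Record resolution (X : lmodType R) := Resolution {
  res_mod : nat -> lmodType R;
  res_d : forall i, {linear res_mod i.+1 -> res_mod i};
  res_aug : {linear res_mod 0%N -> X};
  res_proj : forall i, fg_projective (res_mod i);
  res_surj : surjective_map res_aug;
  res_exact0 : exact_at (res_d 0%N) res_aug;
  res_exact : forall i, exact_at (res_d i.+1) (res_d i) }.

(* The bound is an integer, so that [pd_le (-1) X] says that X = 0. *)
Definition pd_le (n : int) (X : lmodType R) : Prop :=
  exists P : resolution X,
    forall i : nat, (n < i%:Z)%R -> zero_module (res_mod P i).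

(* The cohomology of Hom_R(P, N) in degree i is zero. *)
Definition cohomology_zero (X : lmodType R) (P : resolution X)
    (i : nat) (N : lmodType R) : Prop :=
  forall phi : {linear res_mod P i -> N},
    (forall x, phi (res_d P i x) = 0) ->
    match i return {linear res_mod P i -> N} -> Prop with
    | 0 => fun phi => forall x, phi x = 0
    | j.+1 => fun phi =>
        exists psi : {linear res_mod P j -> N},
          forall x, phi x = psi (res_d P j x)
    end phi.

(* Ext^i_R(X, N) = 0.  Any two resolutions give the same cohomology, and over
   a noetherian ring every finitely generated X has one. *)
Definition Ext_zero (i : nat) (X N : lmodType R) : Prop :=
  forall P : resolution X, cohomology_zero P i N.

(* Equality of the classes of f and g in the stable Hom module. *)
Definition stably_eq (X Y : lmodType R) (f g : X -> Y) : Prop :=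
  exists (P : lmodType R) (u : {linear X -> P}) (v : {linear P -> Y}),
    fg_projective P /\ forall x, f x - g x = v (u x).

Record arrow := Arrow {
  src : lmodType R;
  tgt : lmodType R;
  arrow_map : {linear src -> tgt} }.

(* b represents Omega a: its source and target are syzygies of those of a, and
   it is induced by a lift of a to the projective covers
     0 -> src b -i-> P -p-> src a -> 0
            |b       |h       |a
     0 -> tgt b -j-> Q -q-> tgt a -> 0.
   The class of b in the stable category depends on a only up to the choice of
   syzygies. *)
Definition syzygy_arrow (a b : arrow) : Prop :=
  exists (P Q : lmodType R)
    (i : {linear src b -> P}) (p : {linear P -> src a})
    (j : {linear tgt b -> Q}) (q : {linear Q -> tgt a})
    (h : {linear P -> Q}),
    [/\ fg_projective P /\ fg_projective Q,
        short_exact i p, short_exact j q,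
        (forall x, q (h x) = arrow_map a (p x))
      & (forall x, h (i x) = j (arrow_map b x))].

(* b represents the image of a under the n-fold iterate of Omega. *)
Fixpoint iter_syzygy_arrow (n : nat) (a b : arrow) : Prop :=
  match n with
  | 0 => a = b
  | m.+1 => exists c, syzygy_arrow a c /\ iter_syzygy_arrow m c b
  end.

Definition stably_zero (a : arrow) : Prop :=
  stably_eq (arrow_map a) (fun=> 0).

Definition is_AB_approx (n : nat) (Y X M : lmodType R)
    (i : {linear Y -> X}) (p : {linear X -> M}) : Prop :=
  [/\ fingen Y, fingen X, short_exact i p, pd_le (n%:Z - 1) Y
    & forall l, (1 <= l <= n)%N -> Ext_zero l X R^o].

Definition is_origin_extension (n : nat) (X M P Y : lmodType R)
    (i : {linear X -> (M * P)%type}) (p : {linear (M * P)%type -> Y}) : Prop :=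
  [/\ fingen X /\ fingen Y, fg_projective P, short_exact i p, pd_le n%:Z Y
    & forall l, (1 <= l <= n)%N -> Ext_zero l X R^o].

Definition is_FPD_hull (n : nat) (M Y X : lmodType R)
    (i : {linear M -> Y}) (p : {linear Y -> X}) : Prop :=
  [/\ fingen Y, fingen X, short_exact i p, pd_le n%:Z Y
    & forall l, (1 <= l <= n.+1)%N -> Ext_zero l X R^o].

Definition in_A (n : nat) (M : lmodType R) : Prop :=
  exists (Y X : lmodType R) (i : {linear Y -> X}) (p : {linear X -> M}),
    is_AB_approx n i p.

Definition in_E (n : nat) (M : lmodType R) : Prop :=
  exists (X P Y : lmodType R)
    (i : {linear X -> (M * P)%type}) (p : {linear (M * P)%type -> Y}),
    is_origin_extension n i p.

Definition in_H (n : nat) (M : lmodType R) : Prop :=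
  exists (Y X : lmodType R) (i : {linear M -> Y}) (p : {linear Y -> X}),
    is_FPD_hull n i p.

Definition internal_direct_sum (X : lmodType R) (X0 X1 : set X) : Prop :=
  [/\ submodule X0, submodule X1,
      (forall x, exists x0 x1, [/\ X0 x0, X1 x1 & x = x0 + x1])
    & (forall x, X0 x -> X1 x -> x = 0)].

Definition is_minimal_AB_approx (n : nat) (Y X M : lmodType R)
    (i : {linear Y -> X}) (p : {linear X -> M}) : Prop :=
  is_AB_approx n i p /\
  forall X0 X1 : set X, internal_direct_sum X0 X1 ->
    X0 `<=` range i -> X0 = [set 0].

Definition has_free_summand (X : lmodType R) (r : nat) : Prop :=
  exists (X' : lmodType R) (f : {linear ('rV[R]_r * X')%type -> X}),
    injective_map f /\ surjective_map f.

Definition max_free_rank (X : lmodType R) : nat :=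
  xget 0%N [set r | has_free_summand X r /\
                    forall s, has_free_summand X s -> (s <= r)%N].

Definition bilinear_map (A B W : lmodType R) (b : A -> B -> W) : Prop :=
  (forall (r : R) x x' y, b (r *: x + x') y = r *: b x y + b x' y) /\
  (forall (r : R) x y y', b x (r *: y + y') = r *: b x y + b x y').

Definition is_tensor (A B T : lmodType R) (t : A -> B -> T) : Prop :=
  bilinear_map t /\
  forall (W : lmodType R) (b : A -> B -> W), bilinear_map b ->
    (exists h : {linear T -> W}, forall x y, h (t x y) = b x y) /\
    (forall h h' : {linear T -> W},
       (forall x y, h (t x y) = b x y) -> (forall x y, h' (t x y) = b x y) ->
       forall z, h z = h' z).

(* The map f (x) N is zero. *)
Definition tensor_map_zero (A B : lmodType R) (f : {linear A -> B})
    (N : lmodType R) : Prop :=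
  exists (S T : lmodType R) (s : A -> N -> S) (t : B -> N -> T)
    (F : {linear S -> T}),
    [/\ is_tensor s, is_tensor t, (forall x y, F (s x y) = t (f x) y)
      & forall z, F z = 0].

End Modules.

(* A field k with a surjective ring morphism from a local ring R is the residue
   field of R: the kernel is a maximal ideal, hence the maximal ideal. *)
Definition residue_map (R : comNzRingType) (k : fieldType)
    (res : {rmorphism R -> k}) : Prop :=
  forall y, exists x, res x = y.

(* k as an R-module through res. *)
Definition kmod (R : comNzRingType) (k : fieldType)
    (res : {rmorphism R -> k}) : Type := k.

Section ResidueModule.
Variables (R : comNzRingType) (k : fieldType) (res : {rmorphism R -> k}).

HB.instance Definition _ := GRing.Zmodule.on (kmod res).

Definition kmod_scale (a : R) (x : kmod res) : kmod res := res a * (x : k).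

Fact kmod_scaleA a b x : kmod_scale a (kmod_scale b x) = kmod_scale (a * b) x.
Proof. by rewrite /kmod_scale rmorphM mulrA. Qed.

Fact kmod_scale1 : left_id 1 kmod_scale.
Proof. by move=> x; rewrite /kmod_scale rmorph1 mul1r. Qed.

Fact kmod_scaleDr : right_distributive kmod_scale +%R.
Proof. by move=> a x y; rewrite /kmod_scale mulrDr. Qed.

Fact kmod_scaleDl x : {morph kmod_scale^~ x : a b / a + b}.
Proof. by move=> a b; rewrite /kmod_scale rmorphD mulrDl. Qed.

HB.instance Definition _ := GRing.Zmodule_isLmodule.Build R (kmod res)
  kmod_scaleA kmod_scale1 kmod_scaleDr kmod_scaleDl.

(* W has a basis e of d elements over k, where the k-space structure of
   Hom_R(M, k) is pointwise. *)
Definition has_dim (M : lmodType R) (W : set {linear M -> kmod res})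
    (d : nat) : Prop :=
  exists e : 'I_d -> {linear M -> kmod res},
    (forall c : 'I_d -> k,
       (forall x, \sum_(i < d) c i * (e i x : k) = 0) -> forall i, c i = 0) /\
    (forall f : {linear M -> kmod res},
       W f <-> exists c : 'I_d -> k,
                 forall x, (f x : k) = \sum_(i < d) c i * (e i x : k)).

(* The kernel of Hom(M, k) -> stable Hom(M, k)
   -> stable Hom(Omega^n M, Omega^n k). *)
Definition xi_kernel (n : nat) (M : lmodType R) : set {linear M -> kmod res} :=
  [set f | exists b : arrow R,
             iter_syzygy_arrow n (Arrow f) b /\ stably_zero b].

Definition xi (n : nat) (M : lmodType R) : nat :=
  xget 0%N [set d | has_dim (@xi_kernel n M) d].

End ResidueModule.

(* Main.v *)
Require Import Defs.
From HB Require Import structures.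
From mathcomp Require Import all_boot all_order all_algebra.
From mathcomp Require Import boolp classical_sets.

Set Implicit Arguments.
Unset Strict Implicit.
Unset Printing Implicit Defensive.

Import GRing.Theory.
Local Open Scope ring_scope.

(** Write K_n(f) for the statement that the n-fold syzygy of a map f is zero in
the stable category, so that xi_n(M) is the dimension of the space of all
f : M -> k with K_n(f).  The maps with K_n form a two-sided ideal that contains
the stably zero maps, and K_n does not depend on the choice of the syzygies
([Omega_zero_idealP], [Omega_zero_indep]).  Three facts carry the argument.

- If Ext^i(X, R) = 0 for i = 1, ..., n, then K_n(f) implies that f : X -> N is
  stably zero ([Omega_zero_Ext]): if the syzygy of f factors through a
  projective module, the first factor extends from Omega X to the cover of X,
  and correcting the lift of f by it factors f through the cover of N.
- If pd X <= n, then K_n(f) for every f : X -> N ([Omega_zero_pd]).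
- If 0 -> Y -> X -> M -> 0 is exact with pd Y <= n - 1, then K_n(f p) implies
  K_n(f), where p is the map X -> M ([Omega_zero_descend]): one takes syzygies
  of the whole sequence until Y becomes zero.

A functional X -> k is stably zero iff it lifts to a map X -> R, and the space
of these functionals has as dimension the rank of the largest free summand of X
([max_free_rank_stable]): dual vectors of a basis give a square matrix over R
which is the identity modulo the maximal ideal, so its determinant is a unit.

(1) For an n-AB approximation, K_n(f) holds iff f p is stably zero.  By
minimality every stably zero functional on X vanishes on Y, so it comes from M;
hence xi_n(M) is the dimension of the space of stably zero functionals on X.

(2) A map g f with f : M -> Z, pd Z <= n and g : Z -> k satisfies K_n.
Conversely, given an n-origin extension and f with K_n(f), the restriction of f
to X is stably zero, say through F; the pushout Z of the extension along X -> F
is an extension of Y by F, so pd Z <= n, and f factors through M -> Z.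

(3) For an n-FPD hull, K_n(f) holds iff f extends to Y: the pullback of f to
Omega X is stably zero, its first factor extends to the cover P of X because
Ext^1(X, R) = 0, and Y is a quotient of M x P.  So xi_n(M) is the dimension of
the image of Hom(Y, k) -> Hom(M, k), whose kernel is Hom(X, k); and mu is the
dimension of Hom(-, k) by Nakayama's lemma. *)

(** * Linear maps, submodules and quotients *)

(** The linear map with underlying function [f]. *)
Definition mklin (R : comNzRingType) (U V : lmodType R) (f : U -> V)
    (f_lin : linear f) : {linear U -> V} :=
  HB.pack f (GRing.isLinear.Build R U V *:%R f f_lin).

Section Submodule.
Variables (R : comNzRingType) (V : lmodType R) (A : set V).

Definition submodule_pred of submodule A : {pred V} := fun x => `[< A x >].

Variable A_sub : submodule A.

Fact submodule_pred_closed : submod_closed (submodule_pred A_sub).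
Proof.
case: (A_sub) => A0 AD AZ; split; first exact/asboolP.
by move=> a u v /asboolP Au /asboolP Av; apply/asboolP/AD => //; apply: AZ.
Qed.

HB.instance Definition _ :=
  GRing.isSubmodClosed.Build R V (submodule_pred A_sub) submodule_pred_closed.

(** The submodule [A] as a type. *)
Record subm := Subm { subm_val :> V; _ : subm_val \in submodule_pred A_sub }.

HB.instance Definition _ := [isSub for subm_val].
HB.instance Definition _ := [Choice of subm by <:].
HB.instance Definition _ := [SubChoice_isSubLmodule of subm by <:].

Lemma submodule_module :
  exists (U : lmodType R) (j : {linear U -> V}),
    injective_map j /\ forall v, A v <-> exists u, j u = v.
Proof.
pose U : lmodType R := subm.
have j_lin : linear (val : U -> V) by move=> a x y; rewrite linearP.
exists U, (mklin j_lin); split; first by move=> x y; apply: val_inj.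
move=> v; split=> [Av|[u <-]]; last by case: u => u /= /asboolP.
have vA : v \in submodule_pred A_sub by apply/asboolP.
by exists (Subm vA).
Qed.

End Submodule.

Section Quotient.
Variables (R : comNzRingType) (V : lmodType R) (N : set V).
Hypothesis N_sub : submodule N.

(** The chosen representative of the class of [x] modulo [N]; it depends only on
the class, because the set it is chosen from does. *)
Definition crep (x : V) : V := xget 0 [set y | N (x - y)].

Fact submodule_subr x y : N x -> N y -> N (x - y).
Proof.
case: N_sub => _ ND NZ Nx Ny; apply: ND => //.
by rewrite -scaleN1r; apply: NZ.
Qed.

Fact crepP x : N (x - crep x).
Proof.
apply: (@xgetI _ 0 [set y | N (x - y)] x).
by rewrite /= subrr; case: N_sub.
Qed.

Fact crepPV x : N (crep x - x).
Proof.
by rewrite -opprB -sub0r; apply: submodule_subr (crepP x); case: N_sub.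
Qed.

Fact crep_eq x y : crep x = crep y <-> N (x - y).
Proof.
case: N_sub => N0 ND NZ; split=> [e|Nxy].
  have -> : x - y = (x - crep x) - (y - crep y) by rewrite e opprB addrA subrK.
  by apply: submodule_subr; apply: crepP.
rewrite /crep; congr xget; apply/funext => z; apply/propext; split=> /= h.
  have -> : y - z = (x - z) - (x - y) by rewrite opprB [RHS]addrC addrA subrK.
  exact: submodule_subr.
by have -> : x - z = (x - y) + (y - z); [rewrite addrA subrK|apply: ND].
Qed.

Fact crep_idem x : crep (crep x) = crep x.
Proof. exact/crep_eq/crepPV. Qed.

(** [V / N] as the type of chosen representatives. *)
Record quotm := Quotm { quotm_val :> V; _ : crep quotm_val == quotm_val }.

HB.instance Definition _ := [isSub for quotm_val].
HB.instance Definition _ := [Choice of quotm by <:].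

Definition qclass (x : V) : quotm := @Quotm (crep x) (introT eqP (crep_idem x)).

Fact qclass_eq x y : qclass x = qclass y <-> N (x - y).
Proof.
rewrite -crep_eq; split=> [/(congr1 val)//|e]; exact: val_inj.
Qed.

Fact qclassK (x : quotm) : qclass (val x) = x.
Proof. by apply: val_inj; apply/eqP; case: x. Qed.

Definition qadd (x y : quotm) := qclass (val x + val y).
Definition qopp (x : quotm) := qclass (- val x).
Definition qscale a (x : quotm) := qclass (a *: val x).

Fact qclassD x y : qadd (qclass x) (qclass y) = qclass (x + y).
Proof.
apply/qclass_eq => /=; rewrite opprD addrACA.
by case: N_sub => _ ND _; apply: ND; apply: crepPV.
Qed.

Fact qclassN x : qopp (qclass x) = qclass (- x).
Proof. by apply/qclass_eq => /=; rewrite opprK addrC; apply: crepP. Qed.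

Fact qclassZ a x : qscale a (qclass x) = qclass (a *: x).
Proof.
apply/qclass_eq => /=; rewrite -scalerBr.
by case: N_sub => _ _ NZ; apply: NZ; apply: crepPV.
Qed.

Fact qind (P : quotm -> Prop) : (forall x, P (qclass x)) -> forall x, P x.
Proof. by move=> h x; rewrite -[x]qclassK. Qed.

Fact qaddA : associative qadd.
Proof.
by elim/qind=> ?; elim/qind=> ?; elim/qind=> ?; rewrite !qclassD addrA.
Qed.

Fact qaddC : commutative qadd.
Proof. by elim/qind=> ?; elim/qind=> ?; rewrite !qclassD addrC. Qed.

Fact qadd0 : left_id (qclass 0) qadd.
Proof. by elim/qind=> ?; rewrite qclassD add0r. Qed.

Fact qaddN : left_inverse (qclass 0) qopp qadd.
Proof. by elim/qind=> ?; rewrite qclassN qclassD addNr. Qed.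

HB.instance Definition _ :=
  GRing.isZmodule.Build quotm qaddA qaddC qadd0 qaddN.

Fact qclass_add x y : qclass x + qclass y = qclass (x + y).
Proof. exact: qclassD. Qed.

Fact qscaleA a b x : qscale a (qscale b x) = qscale (a * b) x.
Proof. by elim/qind: x => x; rewrite !qclassZ scalerA. Qed.

Fact qscale1 : left_id 1 qscale.
Proof. by elim/qind=> x; rewrite qclassZ scale1r. Qed.

Fact qscaleDr : right_distributive qscale +%R.
Proof.
move=> a; elim/qind=> x; elim/qind=> y.
by rewrite qclass_add !qclassZ qclass_add scalerDr.
Qed.

Fact qscaleDl x : {morph qscale^~ x : a b / a + b}.
Proof.
by move=> a b /=; elim/qind: x => x; rewrite !qclassZ qclass_add scalerDl.
Qed.

HB.instance Definition _ := GRing.Zmodule_isLmodule.Build R quotm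
  qscaleA qscale1 qscaleDr qscaleDl.

Lemma quotient_module :
  exists (Q : lmodType R) (q : {linear V -> Q}),
    surjective_map q /\ forall v, q v = 0 <-> N v.
Proof.
pose Q : lmodType R := quotm.
have q_lin : linear (qclass : V -> Q).
  by move=> a x y; rewrite -[_ *: qclass x]/(qscale a _) qclassZ qclass_add.
exists Q, (mklin q_lin); split=> [y|v]; first by exists (val y); apply: qclassK.
by rewrite -[0]/(qclass 0) [mklin _ v]/(qclass v) qclass_eq subr0.
Qed.

End Quotient.

Section Factoring.
Variable R : comNzRingType.
Implicit Types U V W Q : lmodType R.

Lemma kernel_module V W (f : {linear V -> W}) :
  exists (K : lmodType R) (j : {linear K -> V}),
    injective_map j /\ exact_at j f.
Proof.
suff /submodule_module[K [j [? jP]]] : submodule [set v | f v = 0].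
  by exists K, j; split=> // v; rewrite -jP.
split=> /= [|x y fx fy|a x fx]; first exact: linear0.
  by rewrite linearD fx fy addr0.
by rewrite linearZ /= fx scaler0.
Qed.

Lemma factor_injective U V W (j : {linear U -> V}) (f : {linear W -> V}) :
    injective_map j -> (forall w, exists u, j u = f w) ->
  exists g : {linear W -> U}, forall w, j (g w) = f w.
Proof.
move=> j_inj /choice[g gP].
have g_lin : linear g.
  by move=> a x y; apply: j_inj; rewrite linearP !gP linearP.
by exists (mklin g_lin).
Qed.

Lemma factor_surjective V Q W (q : {linear V -> Q}) (f : {linear V -> W}) :
    surjective_map q -> (forall v, q v = 0 -> f v = 0) ->
  exists g : {linear Q -> W}, forall v, g (q v) = f v.
Proof.
move=> /choice[s sP] qf.
have fs v : f (s (q v)) = f v.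
  by apply/eqP; rewrite -subr_eq0 -linearB qf // linearB /= sP subrr.
have g_lin : linear (f \o s).
  move=> a x y /=; rewrite -linearP -[RHS]fs; congr (f (s _)).
  by rewrite linearP !sP.
by exists (mklin g_lin) => v; apply: fs.
Qed.

Fact copair_linear U V W (f : {linear U -> W}) (g : {linear V -> W}) :
  linear (fun x : U * V => f x.1 + g x.2).
Proof. by move=> a x y /=; rewrite !linearP scalerDr addrACA. Qed.

(** The map [U x V -> W] which is [f] on [U] and [g] on [V]. *)
Definition copair U V W (f : {linear U -> W}) (g : {linear V -> W}) :
  {linear (U * V)%type -> W} := mklin (copair_linear f g).

Fact pairing_linear U V W (f : {linear U -> V}) (g : {linear U -> W}) :
  linear (fun x => (f x, g x)).
Proof. by move=> a x y; rewrite !linearP. Qed.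

(** The map [U -> V x W] with components [f] and [g]. *)
Definition pairing U V W (f : {linear U -> V}) (g : {linear U -> W}) :
  {linear U -> (V * W)%type} := mklin (pairing_linear f g).

Lemma exact_comp0 U V W (f : {linear U -> V}) (g : {linear V -> W}) u :
  exact_at f g -> g (f u) = 0.
Proof. by move=> fg; apply/fg; exists u. Qed.

End Factoring.

(** * Finitely generated and projective modules *)

Section Free.
Variable R : comNzRingType.
Implicit Types U V W P : lmodType R.

Fact comb_linear V n (e : 'I_n -> V) :
  linear (fun c : 'rV[R]_n => \sum_i c 0 i *: e i).
Proof.
move=> a c d; rewrite scaler_sumr -big_split /=; apply: eq_bigr => i _.
by rewrite !mxE scalerDl scalerA.
Qed.

(** The map from the free module of rank [n] sending the basis to [e]. *)
Definition comb V n (e : 'I_n -> V) : {linear 'rV[R]_n -> V} :=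
  mklin (comb_linear e).

Lemma combE V n (e : 'I_n -> V) c : comb e c = \sum_i c 0 i *: e i.
Proof. by []. Qed.

Lemma comb_delta V n (e : 'I_n -> V) i : comb e (delta_mx 0 i) = e i.
Proof.
rewrite combE (bigD1 i) //= mxE !eqxx scale1r big1 ?addr0 // => j ji.
by rewrite mxE (negbTE ji) andbF scale0r.
Qed.

Lemma comb_comp V W n (e : 'I_n -> V) (f : {linear V -> W}) c :
  f (comb e c) = comb (f \o e) c.
Proof.
by rewrite !combE linear_sum; apply: eq_bigr => i _; rewrite linearZ.
Qed.

Lemma linear_rowE V n (f : {linear 'rV[R]_n -> V}) c :
  f c = comb (fun i => f (delta_mx 0 i)) c.
Proof.
rewrite {1}[c]row_sum_delta combE linear_sum.
by apply: eq_bigr => i _; rewrite linearZ.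
Qed.

Lemma generated_comb V n (e : 'I_n -> V) :
  spans e setT <-> surjective_map (comb e).
Proof.
split=> [eV v|eV v].
  have [c ->] := (eV v).1 I; exists (\row_i c i); rewrite combE.
  by apply: eq_bigr => i _; rewrite mxE.
by split=> // _; have [c <-] := eV v; exists (c 0).
Qed.

Lemma fingenP V :
  fingen V <-> exists n (t : {linear 'rV[R]_n -> V}), surjective_map t.
Proof.
split=> [[n [e /generated_comb eV]]|[n [t tV]]]; first by exists n, (comb e).
exists n, (fun i => t (delta_mx 0 i)); apply/generated_comb => v.
by have [c <-] := tV v; exists c; rewrite -linear_rowE.
Qed.

Lemma fingen_surj V W (f : {linear V -> W}) :
  surjective_map f -> fingen V -> fingen W.
Proof.
move=> f_surj /fingenP[n [t t_surj]]; apply/fingenP; exists n, (f \o t) => w.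
by have [v <-] := f_surj w; have [c <-] := t_surj v; exists c.
Qed.

Lemma fingen_free n : fingen 'rV[R]_n.
Proof. by apply/fingenP; exists n, idfun => x; exists x. Qed.

(** An extension of finitely generated modules is finitely generated; the
quotient is given by elements [e] of [V] whose images generate it. *)
Lemma fingen_ext U V W (j : {linear U -> V}) (f : {linear V -> W}) n
    (e : 'I_n -> V) :
  exact_at j f -> (forall v, exists c, f v = f (comb e c)) -> fingen U ->
  fingen V.
Proof.
move=> jf eW /fingenP[m [t t_surj]]; apply/fingenP.
have h_lin : linear (fun x : 'rV[R]_(n + m) =>
    comb e (lsubmx x) + j (t (rsubmx x))).
  by move=> a x y; rewrite !linearP scalerDr addrACA.
exists (n + m)%N, (mklin h_lin) => v; have [c fv] := eW v.
have /jf[u uE] : f (v - comb e c) = 0 by rewrite linearB /= -fv subrr.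
have [d du] := t_surj u; exists (row_mx c d).
by rewrite /= row_mxKl row_mxKr du uE addrC subrK.
Qed.

Lemma fingen_prod U V : fingen U -> fingen V -> fingen (U * V)%type.
Proof.
move=> /fingenP[n [s s_surj]] /fingenP[m [t t_surj]]; apply/fingenP.
have h_lin : linear (fun x : 'rV[R]_(n + m) => (s (lsubmx x), t (rsubmx x))).
  by move=> a x y; rewrite !linearP.
exists (n + m)%N, (mklin h_lin) => -[u v].
have [c <-] := s_surj u; have [d <-] := t_surj v; exists (row_mx c d).
by rewrite /= row_mxKl row_mxKr.
Qed.

Lemma projective_free n : projective 'rV[R]_n.
Proof.
move=> A B q f q_surj.
have [e eP] := choice (fun i : 'I_n => q_surj (f (delta_mx 0 i))).
exists (comb e) => x; rewrite comb_comp [RHS]linear_rowE !combE.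
by apply: eq_bigr => i _; rewrite /= eP.
Qed.

Lemma fgp_free n : fg_projective 'rV[R]_n.
Proof. by split; [apply: fingen_free|apply: projective_free]. Qed.

Lemma projective_prod U V :
  projective U -> projective V -> projective (U * V)%type.
Proof.
move=> pU pV A B q f q_surj.
have [g gP] := pU A B q (f \o pairing idfun \0) q_surj.
have [h hP] := pV A B q (f \o pairing \0 idfun) q_surj.
exists (copair g h) => -[u v].
rewrite linearD gP hP /= -linearD; congr (f _).
by apply/eqP; rewrite -pair_eqE /pair_eq /= addr0 add0r !eqxx.
Qed.

Lemma fgp_prod U V :
  fg_projective U -> fg_projective V -> fg_projective (U * V)%type.
Proof.
move=> [fU pU] [fV pV].
by split; [apply: fingen_prod|apply: projective_prod].
Qed.

Lemma fgp_retract P : fg_projective P ->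
  exists n (s : {linear P -> 'rV[R]_n}) (t : {linear 'rV[R]_n -> P}),
    forall x, t (s x) = x.
Proof.
move=> [/fingenP[n [t t_surj]] pP].
by have [s sP] := pP _ _ t idfun t_surj; exists n, s, t.
Qed.

Lemma fgp_regular : fg_projective (R^o : lmodType R).
Proof.
split.
  exists 1%N, (fun=> 1 : R^o); apply/generated_comb => x.
  by exists (const_mx x); rewrite combE big_ord1 mxE [LHS]mulr1.
move=> A B q f q_surj; have [a aP] := q_surj (f 1).
have h_lin : linear (fun x : R^o => x *: a).
  by move=> b x y; rewrite scalerDl scalerA.
by exists (mklin h_lin) => x; rewrite linearZ /= aP -linearZ [_ *: 1]mulr1.
Qed.

Lemma free_cover V : fingen V ->
  exists n (K : lmodType R) (i : {linear K -> 'rV[R]_n})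
    (p : {linear 'rV[R]_n -> V}), short_exact i p.
Proof.
move=> /fingenP[n [p p_surj]]; have [K [i [i_inj ip]]] := kernel_module p.
by exists n, K, i, p.
Qed.

End Free.

Section Noetherian.
Variable R : comNzRingType.
Hypothesis R_noeth : noetherian R.
Implicit Types U V W P : lmodType R.

(** Submodules of free modules of finite rank are finitely generated. *)
Lemma fingen_sub_free n V (f : {linear V -> 'rV[R]_n}) :
  injective_map f -> fingen V.
Proof.
elim: n => [|n IHn] in V f *.
  move=> f_inj; apply/fingenP; exists 0%N, \0 => v.
  by exists 0; apply: f_inj; rewrite [LHS]thinmx0 [RHS]thinmx0.
move=> f_inj.
(* The first coordinate maps [V] onto an ideal; its kernel embeds in a free
   module of rank [n]. *)
have g_lin : linear (fun v => f v 0 0 : R^o).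
  by move=> a x y; rewrite linearP !mxE.
pose g : {linear V -> R^o} := mklin g_lin.
have [K [j [j_inj jg]]] := kernel_module g.
have K_fg : fingen K.
  have h_lin : linear (fun x => \row_i f (j x) 0 (lift ord0 i) : 'rV[R]_n).
    by move=> a x y; apply/rowP => i; rewrite !linearP !mxE.
  apply: (IHn _ (mklin h_lin)) => x y /= /rowP xy; apply/j_inj/f_inj/rowP => i.
  have [i' ->|->] := unliftP ord0 i; first by have := xy i'; rewrite !mxE.
  by have := exact_comp0 x jg; have := exact_comp0 y jg => /= -> ->.
have I_ideal : ideal [set a | exists v, g v = a].
  split=> /= [|x y [u <-] [v <-]|a x [u <-]].
    by exists 0; apply: (linear0 g).
    by exists (u + v); apply: (linearD g).
  by exists (a *: u); apply: (linearZ_LR g).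
have [m [e eI]] := R_noeth I_ideal.
have /choice[w wP] : forall i, exists v, g v = e i.
  move=> i; apply/eI; exists (fun l => (l == i)%:R).
  rewrite (bigD1 i) //= eqxx big1 ?addr0 ?[LHS]scale1r // => [|l /negbTE->].
    by rewrite scale1r.
  by rewrite scale0r.
apply: (fingen_ext (e := w) jg) K_fg => v.
have /eI[c cP] : exists u, g u = g v by exists v.
exists (\row_i c i); rewrite [RHS](comb_comp w g) cP combE.
by apply: eq_bigr => i _; rewrite mxE -wP.
Qed.

Lemma fingen_inj U V (j : {linear U -> V}) :
  injective_map j -> fingen V -> fingen U.
Proof.
move=> j_inj /fingenP[n [t t_surj]].
have /submodule_module[P [i [i_inj iP]]] :
    submodule [set c | exists u, j u = t c].
  split=> /= [|x y [u ux] [v vy]|a x [u ux]].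
  - by exists 0; rewrite !linear0.
  - by exists (u + v); rewrite !linearD ux vy.
  - by exists (a *: u); rewrite !linearZ /= ux.
have [|g gP] := factor_injective (f := t \o i) j_inj.
  by move=> x; apply/iP; exists x.
apply: (fingen_surj (f := g)) (fingen_sub_free i_inj) => u.
have [c tc] := t_surj (j u); have /iP[x ix] : exists u, j u = t c by exists u.
by exists x; apply: j_inj; rewrite gP /= ix.
Qed.

Lemma fingen_kernel U V W (i : {linear U -> V}) (p : {linear V -> W}) :
  short_exact i p -> fingen V -> fingen U.
Proof. by case=> i_inj _ _; apply: fingen_inj i_inj. Qed.

End Noetherian.

(** * Resolutions, projective dimension and Ext *)

Section Resolutions.
Variable R : comNzRingType.
Implicit Types X K P N : lmodType R.

Section Extend.
Variables (K P X : lmodType R) (i : {linear K -> P}) (p : {linear P -> X}).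
Hypotheses (P_fgp : fg_projective P) (ip : short_exact i p).
Variable r : resolution K.

Definition extend_mod n : lmodType R := if n is m.+1 then res_mod r m else P.

Definition extend_d n : {linear extend_mod n.+1 -> extend_mod n} :=
  match n return {linear extend_mod n.+1 -> extend_mod n} with
  | 0 => i \o res_aug r
  | m.+1 => res_d r m
  end.

Fact extend_proj n : fg_projective (extend_mod n).
Proof. by case: n => [|n] //=; apply: res_proj. Qed.

Fact extend_surj : surjective_map p. Proof. by case: ip. Qed.

Fact extend_exact0 : exact_at (extend_d 0) p.
Proof.
case: ip => _ e _ v; split=> [/e[u <-]|[u <-]]; last exact: (exact_comp0 _ e).
by have [x <-] := res_surj r u; exists x.
Qed.

Fact extend_exact n : exact_at (extend_d n.+1) (extend_d n).
Proof.
case: n => [|n]; last exact: res_exact.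
case: ip => i_inj _ _ v; rewrite -(res_exact0 v); split=> /= [e|->].
  by apply: i_inj; rewrite e linear0.
exact: linear0.
Qed.

(** A resolution of the syzygy [K] of [X], continued by the cover of [X]. *)
Definition extend_resolution : resolution X :=
  Resolution extend_proj extend_surj extend_exact0 extend_exact.

End Extend.

(** The kernel of the augmentation is resolved by the tail of the resolution. *)
Lemma resolution_tail X (r : resolution X) :
  exists (K : lmodType R) (j : {linear K -> res_mod r 0}) (r' : resolution K),
    short_exact j (res_aug r) /\ forall n, res_mod r' n = res_mod r n.+1.
Proof.
have [K [j [j_inj je]]] := kernel_module (res_aug r).
have [|a aP] := factor_injective (f := res_d r 0) j_inj.
  by move=> w; apply/je/exact_comp0/res_exact0.
have a_surj : surjective_map a.
  move=> x; have /res_exact0[y yP] := exact_comp0 x je.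
  by exists y; apply: j_inj; rewrite aP.
have a_exact : exact_at (res_d r 1) a.
  move=> v; rewrite -(res_exact v) -aP; split=> [->|e].
    exact: linear0.
  by apply: j_inj; rewrite e linear0.
exists K, j, (Resolution (fun n => res_proj r n.+1) a_surj a_exact
                (fun n => @res_exact R X r n.+1)).
by split=> //; split=> //; apply: res_surj.
Qed.

(** Finitely generated modules as a type, so that the choice of a free cover is
a function which can be iterated. *)
Record fgmod := Fgmod {
  fgmod_sort :> lmodType R;
  fgmod_fg : fingen fgmod_sort }.

(** An exact sequence 0 -> K -> R^n -> V -> 0 with K finitely generated. *)
Record free_cover_data (V : fgmod) := FreeCover {
  fc_rank : nat;
  fc_ker : fgmod;
  fc_i : {linear fc_ker -> 'rV[R]_fc_rank};
  fc_p : {linear 'rV[R]_fc_rank -> V};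
  fc_exact : short_exact fc_i fc_p }.

Lemma resolution_exists X :
  noetherian R -> fingen X -> inhabited (resolution X).
Proof.
move=> R_noeth X_fg.
have cover (V : fgmod) : free_cover_data V.
  apply: inhabited_witness; have [n [K [i [p ip]]]] := free_cover (fgmod_fg V).
  have K_fg := fingen_kernel R_noeth ip (@fingen_free R n).
  by constructor; apply: (@FreeCover V n (Fgmod K_fg) i p ip).
pose S := fix S n := if n is m.+1 then fc_ker (cover (S m)) else Fgmod X_fg.
pose P n : lmodType R := 'rV[R]_(fc_rank (cover (S n))).
pose d n : {linear P n.+1 -> P n} :=
  fc_i (cover (S n)) \o fc_p (cover (S n.+1)).
have d_exact n (Y : lmodType R) (q : {linear P n -> Y}) :
    exact_at (fc_i (cover (S n))) q -> exact_at (d n) q.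
  move=> e v; split=> [/e[u <-]|[u <-]]; last exact: (exact_comp0 _ e).
  have [_ _ s] := fc_exact (cover (S n.+1)).
  by have [x <-] := s u; exists x.
constructor; apply: (@Resolution _ _ P d (fc_p (cover (S 0%N)))).
- by move=> n; apply: fgp_free.
- by have [] := fc_exact (cover (S 0%N)).
- by apply: d_exact; have [] := fc_exact (cover (S 0%N)).
move=> n; apply: d_exact => v.
have [i_inj _ _] := fc_exact (cover (S n)).
have [_ e _] := fc_exact (cover (S n.+1)).
rewrite -(e v); split=> [e0|/= ->]; last exact: linear0.
by apply: i_inj; rewrite [LHS]e0 linear0.
Qed.

Lemma pd_le_neg X : pd_le (-1) X -> zero_module X.
Proof.
case=> r rz x; have [y <-] := res_surj r x.
by rewrite (rz 0%N _ y) ?linear0.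
Qed.

Lemma pd_le_syzygy m X : pd_le m X ->
  exists (K P : lmodType R) (i : {linear K -> P}) (p : {linear P -> X}),
    [/\ fg_projective P, short_exact i p & pd_le (m - 1) K].
Proof.
case=> r rz; have [K [j [r' [je r'E]]]] := resolution_tail r.
exists K, (res_mod r 0), j, (res_aug r); split=> //; first exact: res_proj.
exists r' => i; rewrite r'E Num.Theory.ltrBlDr => im; apply: rz.
by rewrite -addn1 PoszD.
Qed.

Lemma pd_le_extend (m : nat) K P X (i : {linear K -> P}) (p : {linear P -> X}) :
  fg_projective P -> short_exact i p -> pd_le (m%:Z - 1) K -> pd_le m X.
Proof.
move=> P_fgp ip [r rz]; exists (extend_resolution P_fgp ip r) => -[//|n] mn.
by apply: rz; rewrite Num.Theory.ltrBlDr -PoszD addn1.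
Qed.

Lemma Ext_zero_syzygy l K P X N (i : {linear K -> P}) (p : {linear P -> X}) :
  fg_projective P -> short_exact i p ->
  Ext_zero l.+2 X N -> Ext_zero l.+1 K N.
Proof. by move=> P_fgp ip XN r; apply: (XN (extend_resolution P_fgp ip r)). Qed.

Lemma Ext1_zero_lift K P X N (i : {linear K -> P}) (p : {linear P -> X}) :
  noetherian R -> fg_projective P -> short_exact i p -> Ext_zero 1 X N ->
  forall u : {linear K -> N}, exists v : {linear P -> N},
    forall x, v (i x) = u x.
Proof.
move=> R_noeth P_fgp ip XN u.
have [r] := resolution_exists R_noeth (fingen_kernel R_noeth ip P_fgp.1).
have [|v vP] := XN (extend_resolution P_fgp ip r) (u \o res_aug r).
  by move=> x /=; rewrite (exact_comp0 _ (@res_exact0 R K r)) linear0.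
by exists v => x; have [y <-] := res_surj r x; apply/esym/vP.
Qed.

(** Ext^1(X, R) = 0 suffices for extending maps into any finitely
generated projective module. *)
Lemma Ext1_zero_lift_fgp K P X F (i : {linear K -> P}) (p : {linear P -> X}) :
  noetherian R -> fg_projective P -> short_exact i p -> Ext_zero 1 X R^o ->
  fg_projective F ->
  forall u : {linear K -> F}, exists v : {linear P -> F},
    forall x, v (i x) = u x.
Proof.
move=> R_noeth P_fgp ip XR /fgp_retract[n [s [t ts]]] u.
have coord_lin (l : 'I_n) : linear (fun x => s (u x) 0 l : R^o).
  by move=> a x y; rewrite !linearP !mxE.
have /choice[w wP] l :=
  Ext1_zero_lift R_noeth P_fgp ip XR (mklin (coord_lin l)).
have w_lin : linear (fun y => \row_l w l y).
  by move=> a x y; apply/rowP => l; rewrite !mxE linearP.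
exists (t \o mklin w_lin) => x; rewrite -[RHS]ts /=; congr (t _).
by apply/rowP => l; rewrite mxE wP.
Qed.

End Resolutions.

(** * The kernel of the iterated syzygy on stable Hom *)

Section OmegaZero.
Variable R : comNzRingType.
Hypothesis R_noeth : noetherian R.
Implicit Types X Y Z K L M N P Q : lmodType R.

(** The n-fold syzygy of [f] is zero in the stable category, for some choice
of the syzygies. *)
Definition Omega_zero n X Y (f : {linear X -> Y}) : Prop :=
  exists b : arrow R, iter_syzygy_arrow n (Arrow f) b /\ stably_zero b.

Lemma Omega_zero0 X Y (f : {linear X -> Y}) :
  Omega_zero 0 f <->
  exists P (u : {linear X -> P}) (v : {linear P -> Y}),
    fg_projective P /\ forall x, f x = v (u x).
Proof.
split=> [[b [<- [P [u [v [P_fgp uv]]]]]]|[P [u [v [P_fgp uv]]]]].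
  by exists P, u, v; split=> // x; rewrite -uv subr0.
exists (Arrow f); split=> //; exists P, u, v; split=> // x.
by rewrite subr0 [LHS]uv.
Qed.

Lemma Omega_zeroS n X Y (f : {linear X -> Y}) :
  Omega_zero n.+1 f <->
  exists X' Y' (g : {linear X' -> Y'}),
    syzygy_arrow (Arrow f) (Arrow g) /\ Omega_zero n g.
Proof.
split=> [[b [[[X' Y' g] [fg gb] bz]]]|[X' [Y' [g [fg [b [gb bz]]]]]]].
  by exists X', Y', g; split=> //; exists b.
by exists b; split=> //; exists (Arrow g).
Qed.

Lemma syzygy_arrow_eq X Y X' Y' (f f' : {linear X -> Y})
    (g : {linear X' -> Y'}) :
  f =1 f' -> syzygy_arrow (Arrow f) (Arrow g) ->
  syzygy_arrow (Arrow f') (Arrow g).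
Proof.
move=> ff' [P [Q [i [p [j [q [h [PQ ip jq qh hi]]]]]]]].
exists P, Q, i, p, j, q, h; split=> // x.
by rewrite qh /= ff'.
Qed.

Lemma Omega_zero_eq n X Y (f f' : {linear X -> Y}) :
  f =1 f' -> Omega_zero n f -> Omega_zero n f'.
Proof.
case: n => [|n] ff'.
  move=> /Omega_zero0[P [u [v [P_fgp uv]]]]; apply/Omega_zero0.
  by exists P, u, v; split=> // x; rewrite -ff'.
move=> /Omega_zeroS[X' [Y' [g [fg gz]]]]; apply/Omega_zeroS.
by exists X', Y', g; split=> //; apply: syzygy_arrow_eq fg.
Qed.

Lemma syzygy_lift X Y K P L Q (f : {linear X -> Y})
    (i : {linear K -> P}) (p : {linear P -> X})
    (j : {linear L -> Q}) (q : {linear Q -> Y}) :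
  projective P -> short_exact i p -> short_exact j q ->
  exists (h : {linear P -> Q}) (g : {linear K -> L}),
    (forall x, q (h x) = f (p x)) /\ (forall x, h (i x) = j (g x)).
Proof.
move=> P_proj [i_inj ip p_surj] [j_inj jq q_surj].
have [h hP] := P_proj _ _ q (f \o p) q_surj.
have [|g gP] := factor_injective (f := h \o i) j_inj.
  by move=> x; apply/jq; rewrite [LHS]hP /= (exact_comp0 _ ip) linear0.
by exists h, g; split=> x; [apply: hP|rewrite gP].
Qed.

(** Two choices of the syzygy of [f] differ by a conjugation with comparison
maps and by a map that factors through a projective module. *)
Lemma syzygy_arrow_compare X Y X1 Y1 X2 Y2 (f : {linear X -> Y})
    (g1 : {linear X1 -> Y1}) (g2 : {linear X2 -> Y2}) :
  syzygy_arrow (Arrow f) (Arrow g1) -> syzygy_arrow (Arrow f) (Arrow g2) ->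
  exists (a : {linear X2 -> X1}) (b : {linear Y1 -> Y2})
    (w : {linear X2 -> Y2}),
    Omega_zero 0 w /\ forall x, g2 x = b (g1 (a x)) + w x.
Proof.
case=> P [Q [i [p [j [q [h [[P_fgp Q_fgp] ip jq qh hi]]]]]]].
case=> P' [Q' [i' [p' [j' [q' [h' [[P'_fgp Q'_fgp] ip' jq' qh' hi']]]]]]].
rewrite /= in i p j q h ip jq qh hi i' p' j' q' h' ip' jq' qh' hi'.
have [s [a [ps sa]]] := syzygy_lift idfun P'_fgp.2 ip' ip.
have [t [b [qt tb]]] := syzygy_lift idfun Q_fgp.2 jq jq'.
have [j'_inj jq'_exact _] := jq'.
have [|w wP] := factor_injective (f := h' \- (t \o h \o s)) j'_inj.
  move=> x; apply/jq'_exact => /=.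
  by rewrite linearB /= qh' qt qh ps subrr.
exists a, b, (w \o i'); split.
  by apply/Omega_zero0; exists P', i', w.
move=> x; apply: j'_inj; rewrite linearD /= wP /= -tb -hi -sa addrC subrK.
exact/esym/hi'.
Qed.

Lemma fingen_syzygy_arrow X Y X' Y' (f : {linear X -> Y})
    (g : {linear X' -> Y'}) :
  syzygy_arrow (Arrow f) (Arrow g) -> fingen X' /\ fingen Y'.
Proof.
case=> P [Q [i [p [j [q [h [[P_fgp Q_fgp] ip jq _ _]]]]]]].
split; first exact: fingen_kernel ip P_fgp.1.
exact: fingen_kernel jq Q_fgp.1.
Qed.

(** The maps whose n-fold syzygy is stably zero contain the stably zero maps
and form a two-sided ideal of the category of finitely generated modules. *)
Definition Omega_zero_ideal n : Prop :=
  [/\ forall X Y (f : {linear X -> Y}), fingen X -> fingen Y ->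
        Omega_zero 0 f -> Omega_zero n f,
      forall X Y (f g : {linear X -> Y}), fingen X -> fingen Y ->
        Omega_zero n f -> Omega_zero n g -> Omega_zero n (f \+ g),
      forall X Y Z (f : {linear X -> Y}) (g : {linear Y -> Z}),
        fingen X -> fingen Y -> fingen Z ->
        Omega_zero n f -> Omega_zero n (g \o f)
    & forall X Y Z (f : {linear X -> Y}) (g : {linear Y -> Z}),
        fingen X -> fingen Y -> fingen Z ->
        Omega_zero n g -> Omega_zero n (g \o f)].

(** For n + 1 the ideal property rests on the independence of the syzygies,
which in turn follows from the ideal property for n. *)
Lemma Omega_zero_ideal_indep n : Omega_zero_ideal n ->
  forall X Y X1 Y1 X2 Y2 (f : {linear X -> Y})
    (g1 : {linear X1 -> Y1}) (g2 : {linear X2 -> Y2}),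
  syzygy_arrow (Arrow f) (Arrow g1) -> syzygy_arrow (Arrow f) (Arrow g2) ->
  Omega_zero n g1 -> Omega_zero n g2.
Proof.
move=> [H0 HD Hl Hr] X Y X1 Y1 X2 Y2 f g1 g2 fg1 fg2 g1z.
have [X1_fg Y1_fg] := fingen_syzygy_arrow fg1.
have [X2_fg Y2_fg] := fingen_syzygy_arrow fg2.
have [a [b [w [wz g2E]]]] := syzygy_arrow_compare fg1 fg2.
apply: (@Omega_zero_eq n _ _ ((b \o g1 \o a) \+ w)) => [x|].
  by rewrite g2E.
by apply: HD => //; [apply: Hr => //; apply: Hl|apply: H0].
Qed.

Lemma Omega_zero_idealP n : Omega_zero_ideal n.
Proof.
elim: n => [|n IHn].
  split=> //.
  - move=> X Y f g _ _ /Omega_zero0[P [u [v [P_fgp uv]]]].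
    move=> /Omega_zero0[P' [u' [v' [P'_fgp uv']]]]; apply/Omega_zero0.
    exists (P * P')%type, (pairing u u'), (copair v v').
    by split=> [|x]; [apply: fgp_prod|rewrite /= uv uv'].
  - move=> X Y Z f g _ _ _ /Omega_zero0[P [u [v [P_fgp uv]]]].
    apply/Omega_zero0.
    by exists P, u, (g \o v); split=> // x; rewrite /= uv.
  move=> X Y Z f g _ _ _ /Omega_zero0[P [u [v [P_fgp uv]]]]; apply/Omega_zero0.
  by exists P, (u \o f), v; split=> // x; rewrite /= uv.
have indep := Omega_zero_ideal_indep IHn.
have [IH0 IHD IHl IHr] := IHn.
split.
- move=> X Y f /free_cover[m [K [i [p ip]]]] /free_cover[l [L [j [q jq]]]].
  move=> /Omega_zero0[P [u [v [P_fgp uv]]]]; apply/Omega_zeroS.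
  have [_ _ q_surj] := jq; have [v' qv'] := P_fgp.2 _ _ q v q_surj.
  exists K, L, \0; split.
    exists 'rV[R]_m, 'rV[R]_l, i, p, j, q, (v' \o u \o p).
    split=> // [|x|x] /=; first by split; apply: fgp_free.
      by rewrite qv' uv.
    by have [_ e _] := ip; rewrite (exact_comp0 _ e) !linear0.
  apply: IH0; [exact: fingen_kernel ip (@fingen_free R m)
              |exact: fingen_kernel jq (@fingen_free R l)|].
  by apply/Omega_zero0; exists 'rV[R]_0, \0, \0; split=> //; apply: fgp_free.
- move=> X Y f g X_fg Y_fg /Omega_zeroS[X' [Y' [f' [ff' f'z]]]].
  move=> /Omega_zeroS[X'' [Y'' [g'' [gg'' g''z]]]]; apply/Omega_zeroS.
  have [X'_fg Y'_fg] := fingen_syzygy_arrow ff'.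
  have := ff' => -[P [Q [i [p [j [q [h [PQ_fgp ip jq qh hi]]]]]]]].
  have [h' [g' [qh' hi']]] := syzygy_lift g PQ_fgp.1.2 ip jq.
  have g'z : Omega_zero n g'.
    by apply: indep gg'' _ g''z; exists P, Q, i, p, j, q, h'.
  exists X', Y', (f' \+ g'); split; last exact: IHD.
  exists P, Q, i, p, j, q, (h \+ h'); split=> // x /=.
    by rewrite linearD qh qh'.
  by rewrite linearD hi hi'.
- move=> X Y Z f g X_fg Y_fg Z_fg /Omega_zeroS[X' [Y' [f' [ff' f'z]]]].
  have [X'_fg Y'_fg] := fingen_syzygy_arrow ff'; apply/Omega_zeroS.
  have := ff' => -[P [Q [i [p [j [q [h [PQ_fgp ip jq qh hi]]]]]]]].
  have [l [L [c [s cs]]]] := free_cover Z_fg.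
  have [h' [g' [qh' hi']]] := syzygy_lift g PQ_fgp.2.2 jq cs.
  exists X', L, (g' \o f'); split.
    exists P, 'rV[R]_l, i, p, c, s, (h' \o h).
    split=> // [|x|x] /=; first by split; [apply: PQ_fgp.1|apply: fgp_free].
      by rewrite qh' qh.
    by rewrite hi hi'.
  by apply: IHl => //; apply: fingen_kernel cs (@fingen_free R l).
move=> X Y Z f g X_fg Y_fg Z_fg /Omega_zeroS[X' [Y' [f' [ff' f'z]]]].
have [X'_fg Y'_fg] := fingen_syzygy_arrow ff'; apply/Omega_zeroS.
have := ff' => -[P [Q [i [p [j [q [h [PQ_fgp ip jq qh hi]]]]]]]].
have [l [L [c [s cs]]]] := free_cover X_fg.
have [h' [g' [qh' hi']]] := syzygy_lift f (@projective_free R l) cs ip.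
exists L, Y', (f' \o g'); split.
  exists 'rV[R]_l, Q, c, s, j, q, (h \o h').
  split=> // [|x|x] /=; first by split; [apply: fgp_free|apply: PQ_fgp.2].
    by rewrite qh qh'.
  by rewrite hi' hi.
by apply: IHr => //; apply: fingen_kernel cs (@fingen_free R l).
Qed.


(** The choice of the syzygies in [Omega_zero] does not matter. *)
Lemma Omega_zero_indep n X Y X1 Y1 X2 Y2 (f : {linear X -> Y})
    (g1 : {linear X1 -> Y1}) (g2 : {linear X2 -> Y2}) :
  syzygy_arrow (Arrow f) (Arrow g1) -> syzygy_arrow (Arrow f) (Arrow g2) ->
  Omega_zero n g1 -> Omega_zero n g2.
Proof.
exact/Omega_zero_ideal_indep/Omega_zero_idealP.
Qed.

Lemma Omega_zero_stable n X Y (f : {linear X -> Y}) :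
  fingen X -> fingen Y -> Omega_zero 0 f -> Omega_zero n f.
Proof. by have [h _ _ _] := Omega_zero_idealP n; apply: h. Qed.

Lemma Omega_zeroD n X Y (f g : {linear X -> Y}) :
  fingen X -> fingen Y ->
  Omega_zero n f -> Omega_zero n g -> Omega_zero n (f \+ g).
Proof. by have [_ h _ _] := Omega_zero_idealP n; apply: h. Qed.

Lemma Omega_zero_comp n X Y Z (f : {linear X -> Y}) (g : {linear Y -> Z}) :
  fingen X -> fingen Y -> fingen Z -> Omega_zero n f -> Omega_zero n (g \o f).
Proof. by have [_ _ h _] := Omega_zero_idealP n; apply: h. Qed.

Lemma Omega_zero_precomp n X Y Z (f : {linear X -> Y}) (g : {linear Y -> Z}) :
  fingen X -> fingen Y -> fingen Z -> Omega_zero n g -> Omega_zero n (g \o f).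
Proof. by have [_ _ _ h] := Omega_zero_idealP n; apply: h. Qed.

Lemma Omega_zeroZ n X Y a (f : {linear X -> Y}) :
  fingen X -> fingen Y -> Omega_zero n f -> Omega_zero n (a \*: f).
Proof.
move=> X_fg Y_fg fz.
have aY_lin : linear (fun y : Y => a *: y).
  by move=> b x y; rewrite scalerDr !scalerA mulrC.
apply: (@Omega_zero_eq _ _ _ (mklin aY_lin \o f)) => //.
exact: Omega_zero_comp.
Qed.

(** Stable Hom(X, Y) -> stable Hom(Omega^n X, Omega^n Y) is injective if
Ext^i(X, R) = 0 for i = 1, ..., n. *)
Lemma Omega_zero_Ext n X Y (f : {linear X -> Y}) :
  fingen X -> fingen Y -> (forall l, (1 <= l <= n)%N -> Ext_zero l X R^o) ->
  Omega_zero n f -> Omega_zero 0 f.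
Proof.
elim: n => [//|n IHn] in X Y f *.
move=> X_fg Y_fg XR /Omega_zeroS[X' [Y' [g [fg gz]]]].
have [X'_fg Y'_fg] := fingen_syzygy_arrow fg.
have [P [Q [i [p [j [q [h [[P_fgp Q_fgp] ip jq qh hi]]]]]]]] := fg.
rewrite /= in i p j q h ip jq qh hi.
have : Omega_zero 0 g.
  apply: IHn => // -[|l] // ln; apply: Ext_zero_syzygy P_fgp ip _.
  exact: (XR l.+2).
case/Omega_zero0=> F [u [v [F_fgp uv]]].
have [u' u'P] := Ext1_zero_lift_fgp R_noeth P_fgp ip (XR 1%N isT) F_fgp u.
have [_ ip_exact p_surj] := ip; have [_ jq_exact _] := jq.
(* Subtracting j v u' from h makes it vanish on X'. *)
have [|w wP] := factor_surjective (f := h \- (j \o v \o u')) p_surj.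
  by move=> _ /ip_exact[x <-]; rewrite /= hi u'P uv subrr.
apply/Omega_zero0; exists Q, w, q; split=> // x; have [y <-] := p_surj x.
by rewrite wP /= linearB /= qh (exact_comp0 _ jq_exact) subr0.
Qed.

Lemma short_exact_zero_iso Y X M (i : {linear Y -> X}) (p : {linear X -> M}) :
  short_exact i p -> zero_module Y ->
  exists s : {linear M -> X}, (forall x, p (s x) = x) /\ forall x, s (p x) = x.
Proof.
case=> _ ip p_surj Y0.
have p_inj : injective_map p.
  move=> x y xy; apply/eqP; rewrite -subr_eq0; apply/eqP.
  have /ip[u <-] : p (x - y) = 0 by rewrite linearB xy subrr.
  by rewrite [u]Y0 linear0.
have [s sP] := factor_injective (f := idfun) p_inj p_surj.
by exists s; split=> // x; apply/p_inj/sP.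
Qed.

Lemma Omega_zero_pd (n : nat) X Y (f : {linear X -> Y}) :
  fingen Y -> pd_le n X -> Omega_zero n f.
Proof.
elim: n => [|n IHn] in X Y f * => Y_fg;
  case/pd_le_syzygy=> K [P [i [p [P_fgp ip Kpd]]]].
  have [s [ps _]] := short_exact_zero_iso ip (pd_le_neg Kpd).
  by apply/Omega_zero0; exists P, s, (f \o p); split=> // x; rewrite /= ps.
have [l [L [j [q jq]]]] := free_cover Y_fg.
have [h [g [qh hi]]] := syzygy_lift f P_fgp.2 ip jq.
apply/Omega_zeroS; exists K, L, g; split.
  exists P, 'rV[R]_l, i, p, j, q, h.
  by split=> //; split=> //; apply: fgp_free.
apply: IHn; first exact: fingen_kernel jq (@fingen_free R l).
by move: Kpd; rewrite -addn1 PoszD addrK.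
Qed.

(** If pd Y <= n - 1, the n-fold syzygy of [p] in 0 -> Y -> X -> M -> 0 is a
stable isomorphism; the proof takes syzygies of the whole sequence. *)
Lemma Omega_zero_descend (n : nat) Y X M N
    (i : {linear Y -> X}) (p : {linear X -> M}) (f : {linear M -> N}) :
  fingen X -> fingen N -> short_exact i p -> pd_le (n%:Z - 1) Y ->
  Omega_zero n (f \o p) -> Omega_zero n f.
Proof.
elim: n => [|n IHn] in Y X M N i p f *.
  move=> _ _ ip /pd_le_neg Y0 /Omega_zero0[P [u [v [P_fgp uv]]]].
  have [s [ps _]] := short_exact_zero_iso ip Y0.
  apply/Omega_zero0; exists P, (u \o s), v; split=> // x.
  by rewrite /= -uv /= ps.
move=> X_fg N_fg ip Ypd' fpz.
have Ypd : pd_le n Y by move: Ypd'; rewrite -addn1 PoszD addrK.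
have [i_inj ip_exact p_surj] := ip.
have M_fg := fingen_surj p_surj X_fg.
have [K [P [k [a [P_fgp ka Kpd]]]]] := pd_le_syzygy Ypd.
have [m [L [l [b lb]]]] := free_cover M_fg.
have [c [C [e [d ed]]]] := free_cover N_fg.
have [k_inj ka_exact a_surj] := ka; have [l_inj lb_exact b_surj] := lb.
have [b' pb'] := (@projective_free R m) _ _ p b p_surj.
pose s : {linear (P * 'rV[R]_m)%type -> X} := copair (i \o a) b'.
have s_surj : surjective_map s.
  move=> x; have [w bw] := b_surj (p x).
  have /ip_exact[y iy] : p (x - b' w) = 0 by rewrite linearB /= pb' bw subrr.
  have [z az] := a_surj y; exists (z, w).
  by rewrite /= az iy subrK.
have ps z : p (s z) = b z.2.
  by rewrite /= linearD /= (exact_comp0 _ ip_exact) add0r pb'.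
have [S [t [t_inj ts_exact]]] := kernel_module s.
have ts : short_exact t s by split.
(* The sequence 0 -> K -> S -> L -> 0 of syzygies. *)
have [|r rP] := factor_injective (f := snd \o t) l_inj.
  by move=> x; apply/lb_exact; rewrite -ps (exact_comp0 _ ts_exact) linear0.
have [|o oP] := factor_injective (f := pairing k \0) t_inj.
  move=> x; apply/ts_exact.
  by rewrite /= (exact_comp0 _ ka_exact) !linear0 addr0.
have os : short_exact o r.
  split.
  - move=> x y xy; apply: k_inj.
    by have := congr1 t xy; rewrite !oP => -[].
  - move=> x; split=> [rx|[y <-]].
      have tx2 : (t x).2 = 0 by rewrite -[LHS]rP rx linear0.
      have : s (t x) = 0 by apply: exact_comp0 ts_exact.
      rewrite /= tx2 linear0 addr0 -(linear0 i) => /i_inj/ka_exact[y ky].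
      exists y; apply: t_inj; rewrite oP /= ky -tx2.
      by case: (t x).
    by apply: l_inj; rewrite rP /= oP linear0.
  move=> y; have /ip_exact[z iz] : p (b' (l y)) = 0.
    by rewrite pb' (exact_comp0 _ lb_exact).
  have [w aw] := a_surj (- z).
  have /ts_exact[x tx] : s (w, l y) = 0 by rewrite /= aw linearN iz addNr.
  by exists x; apply: l_inj; rewrite rP /= tx.
have [h [g [dh hl]]] := syzygy_lift f (@projective_free R m) lb ed.
have Pm_fgp := fgp_prod P_fgp (@fgp_free R m).
have gr_fp : syzygy_arrow (Arrow (f \o p)) (Arrow (g \o r)).
  exists (P * 'rV[R]_m)%type, 'rV[R]_c, t, s, e, d, (h \o snd).
  split=> // [|x|x]; first by split=> //; apply: fgp_free.
    by rewrite [LHS]dh [RHS]/= ps.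
    by rewrite /= -[(t x).2]rP hl.
have fg : syzygy_arrow (Arrow f) (Arrow g).
  exists 'rV[R]_m, 'rV[R]_c, l, b, e, d, h.
  by split=> //; split; apply: fgp_free.
have [S_fg C_fg] := fingen_syzygy_arrow gr_fp.
apply/Omega_zeroS; exists L, C, g; split=> //.
apply: IHn os Kpd _ => //.
move/Omega_zeroS: fpz => [X' [Y' [g' [fpg' g'z]]]].
exact: Omega_zero_indep fpg' gr_fp g'z.
Qed.

End OmegaZero.

(** * Functionals with values in the residue field *)

(** A linear subspace of k^n is the row space of a matrix of maximal rank among
those whose rows lie in the subspace. *)
Lemma subspace_row_basis (k : fieldType) n (S : set 'rV[k]_n) :
  S 0 -> (forall u v, S u -> S v -> S (u + v)) ->
  (forall a u, S u -> S (a *: u)) ->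
  exists d (A : 'M[k]_(d, n)), row_free A /\ forall v, S v <-> (v <= A)%MS.
Proof.
move=> S0 SD SZ.
pose p r := `[< exists B : 'M[k]_n,
  (forall v : 'rV_n, (v <= B)%MS -> S v) /\ \rank B = r >].
have p0 : exists r, p r.
  exists 0%N; apply/asboolP; exists 0; rewrite mxrank0; split=> // v.
  by rewrite submx0 => /eqP ->.
have p_bound r : p r -> (r <= n)%N.
  by move=> /asboolP[B [_ <-]]; apply: rank_leq_row.
have [r /asboolP[B [BS rB]] rmax] := ex_maxnP p0 p_bound.
exists _, (row_base B); split=> [|v]; first exact: row_base_free.
rewrite eq_row_base; split=> [Sv|/BS//].
have /rmax : p (\rank (B + v)%MS).
  apply/asboolP; exists (B + v)%MS; split=> // w /sub_addsmxP[[x y] ->].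
  apply: SD; first exact/BS/submxMl.
  by rewrite [y]mx11_scalar mul_scalar_mx; apply: SZ.
rewrite -rB => le_r.
have vB : (B + v <= B)%MS.
  by rewrite -(geq_leqif (mxrank_leqif_sup (addsmxSl B v))).
exact: submx_trans (addsmxSr _ _) vB.
Qed.

Section Residue.
Variables (R : comNzRingType) (k : fieldType) (res : {rmorphism R -> k}).
Hypothesis res_surj : residue_map res.
Implicit Types V X Y M : lmodType R.

(** An element outside the kernel of the residue map is a unit: by Zorn's lemma
a nonunit lies in a maximal ideal, and the kernel is the only one. *)
Lemma residue_unit a : local_ring R -> res a != 0 -> exists b, b * a = 1.
Proof.
move=> [m [m_max m_uniq]] ra; apply: contrapT => a_nunit.
have ker_max : maximal_ideal [set x | res x = 0].
  split=> [|/= /eqP|J [J0 JD JZ] KJ J1]; last 2 first.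
  - by rewrite rmorph1 oner_eq0.
  - apply/seteqP; split=> // x Jx /=; apply: contrapT => /eqP rx; apply: J1.
    have [y ry] := res_surj (res x)^-1.
    rewrite -[1](subrK (y * x)); apply: JD; last exact: JZ.
    by apply: KJ; rewrite /= rmorphB rmorph1 rmorphM ry mulVf ?subrr.
  split=> /= [|x y rx ry|b x rx]; first exact: rmorph0.
    by rewrite rmorphD rx ry addr0.
  by rewrite rmorphM rx mulr0.
(* The empty set is admitted because it is the union of the empty chain. *)
pose P (A : set R) := A = set0 \/ [/\ ideal A, A a & ~ A 1].
have P_ideal A x : P A -> A x -> [/\ ideal A, A a & ~ A 1].
  by case=> [->|].
have [F FP F_tot|A [PA A_max]] := @Zorn_bigcup R P.
  have [[B [FB [x Bx]]]|F0] :=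
    pselect (exists B, F B /\ exists x, B x); last first.
    left; apply/seteqP; split=> // x [B FB Bx].
    by apply: F0; exists B; split=> //; exists x.
  have [[B0 _ _] Ba _] := P_ideal _ _ (FP _ FB) Bx.
  right; split; [|by exists B|]; last first.
    by case=> C FC C1; have [_ _ /(_ C1)] := P_ideal _ _ (FP _ FC) C1.
  split=> [|y z [C FC Cy] [D FD Dz]|b y [C FC Cy]]; first by exists B.
    have [[_ CD _] _ _] := P_ideal _ _ (FP _ FC) Cy.
    have [[_ DD _] _ _] := P_ideal _ _ (FP _ FD) Dz.
    case: (F_tot C D FC FD) => s.
      by exists D => //; apply: DD => //; apply: s.
    by exists C => //; apply: CD => //; apply: s.
  by exists C => //; have [[_ _ CZ] _ _] := P_ideal _ _ (FP _ FC) Cy; apply: CZ.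
have a_ideal : ideal [set x | exists b, x = b * a].
  split=> /= [|x y [b ->] [c ->]|b x [c ->]]; first by exists 0; rewrite mul0r.
    by exists (b + c); rewrite mulrDl.
  by exists (b * c); rewrite -mulrA.
have [A_ideal Aa A1] : [/\ ideal A, A a & ~ A 1].
  case: PA => // A0; have := A_max [set x | exists b, x = b * a]%classic.
  case.
    rewrite A0 properEneq; split=> //; apply/eqP => /seteqP[_ /(_ a)].
    by apply; exists 1; rewrite mul1r.
  right; split=> //; first by exists 1; rewrite mul1r.
  by case=> b e; apply: a_nunit; exists b.
suff A_maxideal : maximal_ideal A.
  have /eqP := ra; apply; have AE := m_uniq _ A_maxideal.
  by have := m_uniq _ ker_max => mE; move: Aa; rewrite -AE mE.
split=> // J J_ideal AJ J1; apply: contrapT => JA.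
apply: (A_max J); last by right; split=> //; apply: AJ.
by rewrite properEneq; split=> //; apply/eqP => e; apply: JA.
Qed.

Fact residue_linear : linear (res : R^o -> kmod res).
Proof. by move=> a x y; rewrite rmorphD rmorphM. Qed.

(** The residue map R -> k as a map of R-modules. *)
Definition residue_lin : {linear R^o -> kmod res} := mklin residue_linear.

Lemma functional_comb V n (e : 'I_n -> V) (f : {linear V -> kmod res}) c :
  (f (comb e c) : k) = \sum_i res (c 0 i) * (f (e i) : k).
Proof.
rewrite combE linear_sum; apply: eq_bigr => i _.
by rewrite linearZ.
Qed.

(** A set of functionals which is a submodule of Hom(V, k), in terms of the
values of the functionals. *)
Definition hom_subspace V (W : set {linear V -> kmod res}) : Prop :=
  [/\ forall f g : {linear V -> kmod res}, f =1 g -> W f -> W g,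
      W \0,
      forall f g : {linear V -> kmod res}, W f -> W g -> W (f \+ g)
    & forall (a : R) (f : {linear V -> kmod res}), W f -> W (a \*: f)].

(** Linear independence over k, for the pointwise k-space structure. *)
Definition independent V d (e : 'I_d -> {linear V -> kmod res}) : Prop :=
  forall c : 'I_d -> k,
    (forall x, \sum_(i < d) c i * (e i x : k) = 0) -> forall i, c i = 0.

Lemma independent_neq0 V d (e : 'I_d -> {linear V -> kmod res}) i :
  independent e -> exists x, e i x <> 0.
Proof.
move=> e_ind; apply: contrapT => e0.
suff /eqP : (i == i)%:R = 0 :> k by rewrite eqxx oner_eq0.
apply: (e_ind (fun j => (j == i)%:R)) => x; rewrite (bigD1 i) //= big1.
  rewrite eqxx mul1r addr0; apply: contrapT => ex; apply: e0.
  by exists x.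
by move=> j /negbTE ->; rewrite mul0r.
Qed.

Lemma has_dim_exists V (W : set {linear V -> kmod res}) :
  fingen V -> hom_subspace W -> exists d, has_dim W d.
Proof.
move=> [n [g /generated_comb g_surj]] [W_eq W0 WD WZ].
pose ev (f : {linear V -> kmod res}) : 'rV[k]_n := \row_j f (g j).
have evE f f' : ev f = ev f' -> f =1 f'.
  move=> /rowP e x; have [c <-] := g_surj x.
  rewrite [LHS]functional_comb [RHS]functional_comb; apply: eq_bigr => j _.
  by have := e j; rewrite !mxE => ->.
have [|u v [f [Wf <-]] [f' [Wf' <-]]|a u [f [Wf <-]]|d [A [A_free AP]]] :=
    @subspace_row_basis k n [set v | exists f, W f /\ ev f = v]%classic.
- by exists \0; split=> //; apply/rowP => j; rewrite !mxE.
- by exists (f \+ f'); split; [apply: WD|apply/rowP => j; rewrite !mxE].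
- have [b <-] := res_surj a; exists (b \*: f).
  by split; [apply: WZ|apply/rowP => j; rewrite !mxE].
have /choice[e eP] i : exists f, W f /\ ev f = row i A by apply/AP/row_sub.
have eE (c : 'I_d -> k) j :
    \sum_i c i * (e i (g j) : k) = ((\row_i c i) *m A) 0 j.
  rewrite mxE; apply: eq_bigr => i _.
  by have [_ /rowP/(_ j)] := eP i; rewrite !mxE => ->.
exists d, e; split=> [c c0|f].
  suff /rowP c_eq0 : \row_i c i = 0 by move=> i; have := c_eq0 i; rewrite !mxE.
  apply: (row_free_inj A_free); rewrite mul0mx; apply/rowP => j.
  by rewrite -eE c0 mxE.
have agree c : ev f = (\row_i c i) *m A <->
    forall x, (f x : k) = \sum_i c i * (e i x : k).
  split=> [/rowP fA x|fE]; last first.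
    by apply/rowP => j; rewrite -eE mxE fE.
  have [b <-] := g_surj x; rewrite [LHS]functional_comb.
  transitivity (\sum_i \sum_j c i * (res (b 0 j) * (e i (g j) : k))).
    rewrite exchange_big; apply: eq_bigr => j _; have := fA j.
    rewrite -eE mxE => ->; rewrite mulr_sumr; apply: eq_bigr => i _.
    by rewrite mulrCA.
  by apply: eq_bigr => i _; rewrite -mulr_sumr functional_comb.
split=> [Wf|[c /agree fA]].
  have /AP/submxP[D DA] : exists f', W f' /\ ev f' = ev f by exists f.
  exists (fun i => D 0 i); apply/agree; rewrite DA; congr (_ *m A).
  by apply/rowP => i; rewrite mxE.
have /AP[f' [Wf' f'E]] : (ev f <= A)%MS by rewrite fA submxMl.
exact: W_eq (evE _ _ f'E) Wf'.
Qed.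

Lemma independent_row_free V d n (e : 'I_d -> {linear V -> kmod res})
    (g : 'I_n -> V) :
  surjective_map (comb g) -> independent e ->
  row_free (\matrix_(i < d, j < n) (e i (g j) : k)).
Proof.
move=> g_surj e_ind; apply: inj_row_free => v /rowP vE.
apply/rowP => i; rewrite [RHS]mxE.
apply: (e_ind (fun i => v 0 i)) => x; have [c <-] := g_surj x.
transitivity (\sum_j res (c 0 j) * \sum_i v 0 i * (e i (g j) : k)).
  under eq_bigr do rewrite functional_comb mulr_sumr.
  rewrite exchange_big; apply: eq_bigr => j _; rewrite mulr_sumr.
  by apply: eq_bigr => l _; rewrite mulrCA.
apply: big1 => j _; have := vE j; rewrite !mxE => e0.
suff -> : \sum_i v 0 i * (e i (g j) : k) = 0 by rewrite mulr0.
by rewrite -[RHS]e0; apply: eq_bigr => l _; rewrite mxE.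
Qed.

Lemma dual_vectors V d (e : 'I_d -> {linear V -> kmod res}) :
  fingen V -> independent e ->
  exists y : 'I_d -> V, forall i j, (e i (y j) : k) = (i == j)%:R.
Proof.
move=> [n [g /generated_comb g_surj]] e_ind.
have /row_freeP[B EB] := independent_row_free g_surj e_ind.
have /choice[b bP] (j : 'I_n) :
    exists b : 'I_d -> R, forall i, res (b i) = B j i.
  by have /choice[b bP] := fun i => res_surj (B j i); exists b.
exists (fun i => comb g (\row_j b j i)) => i j.
rewrite functional_comb; have /matrixP/(_ i j) := EB; rewrite !mxE => <-.
by apply: eq_bigr => l _; rewrite !mxE bP mulrC.
Qed.

Lemma dual_independent V d (e : 'I_d -> {linear V -> kmod res})
    (y : 'I_d -> V) :
  (forall i j, (e i (y j) : k) = (i == j)%:R) -> independent e.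
Proof.
move=> ey c c0 i; rewrite -[RHS](c0 (y i)) (bigD1 i) //= ey eqxx mulr1.
by rewrite big1 ?addr0 // => j /negbTE ji; rewrite ey ji mulr0.
Qed.

Lemma has_dim_bound V (W : set {linear V -> kmod res}) d s
    (f : 'I_s -> {linear V -> kmod res}) :
  has_dim W d -> (forall i, W (f i)) -> independent f -> (s <= d)%N.
Proof.
move=> [e [_ eP]] fW f_ind.
have /choice[c cP] i := (eP (f i)).1 (fW i).
suff /eqP <- : row_free (\matrix_(i < s, l < d) c i l) by apply: rank_leq_col.
apply: inj_row_free => v /rowP vc; apply/rowP => i; rewrite [RHS]mxE.
apply: (f_ind (fun i => v 0 i)) => x.
transitivity (\sum_l (\sum_i v 0 i * c i l) * (e l x : k)).
  transitivity (\sum_i \sum_l v 0 i * (c i l * (e l x : k))).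
    by apply: eq_bigr => l _; rewrite cP mulr_sumr.
  rewrite exchange_big; apply: eq_bigr => l _; rewrite mulr_suml.
  by apply: eq_bigr => j _; rewrite mulrA.
apply: big1 => l _; have := vc l; rewrite !mxE => e0.
suff -> : \sum_i v 0 i * c i l = 0 by rewrite mul0r.
by rewrite -[RHS]e0; apply: eq_bigr => j _; rewrite mxE.
Qed.

Lemma has_dim_basis V (W : set {linear V -> kmod res}) d
    (e : 'I_d -> {linear V -> kmod res}) i :
  (forall f : {linear V -> kmod res}, W f <-> exists c : 'I_d -> k,
    forall x, (f x : k) = \sum_(i < d) c i * (e i x : k)) -> W (e i).
Proof.
move=> eP; apply/eP; exists (fun j => (j == i)%:R) => x.
rewrite (bigD1 i) //= eqxx mul1r big1 ?addr0 // => j /negbTE->.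
by rewrite mul0r.
Qed.

Lemma has_dim_uniq V (W : set {linear V -> kmod res}) d d' :
  has_dim W d -> has_dim W d' -> d = d'.
Proof.
move=> Wd Wd'; apply/eqP; rewrite eqn_leq.
have [e [e_ind eP]] := Wd; have [e' [e'_ind e'P]] := Wd'.
rewrite (has_dim_bound Wd' (fun i => has_dim_basis i eP) e_ind).
exact: (has_dim_bound Wd (fun i => has_dim_basis i e'P) e'_ind).
Qed.

Lemma xi_has_dim n M d : has_dim (@xi_kernel R k res n M) d -> xi res n M = d.
Proof.
move=> Wd; apply: xget_unique => // d' Wd'; exact: has_dim_uniq Wd' Wd.
Qed.

End Residue.

(** * Nakayama's lemma, numbers of generators and tensor products with k *)

Section LocalRing.
Variables (R : comNzRingType) (k : fieldType) (res : {rmorphism R -> k}).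
Hypothesis R_local : local_ring R.
Hypothesis res_surj : residue_map res.
Implicit Types V X Y M N : lmodType R.

(** Nakayama's lemma in dual form: a proper submodule of a finitely generated
module is killed by a nonzero functional. *)
Lemma nakayama_functional V (N : set V) :
  fingen V -> submodule N -> (exists v, ~ N v) ->
  exists g : {linear V -> kmod res},
    (forall v, N v -> g v = 0) /\ exists v, g v <> 0.
Proof.
move=> [n [e /generated_comb e_surj]] N_sub N_proper.
have {e_surj} : forall v, exists u c, N u /\ v = u + comb e c.
  move=> v; have [c <-] := e_surj v; exists 0, c; rewrite add0r.
  by case: N_sub.
elim: n => [|n IHn] in e N N_sub N_proper *.
  move=> eV; have [v []] := N_proper; have [u [c [Nu ->]]] := eV v.
  by rewrite combE big_ord0 addr0.
move=> eV; have [N0 ND NZ] := N_sub; pose e0 := e ord0.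
(* Adjoin the first generator to N. *)
pose N' : set V := fun v => exists u (a : R), N u /\ v = u + a *: e0.
have N'_sub : submodule N'.
  split=> [|x y [u [a [Nu ->]]] [v [b [Nv ->]]]|b x [u [a [Nu ->]]]].
  - by exists 0, 0; rewrite scale0r addr0.
  - by exists (u + v), (a + b); rewrite scalerDl addrACA; split=> //; apply: ND.
  - exists (b *: u), (b * a); rewrite scalerDr scalerA.
    by split=> //; apply: NZ.
have [N'_proper|N'_full] := pselect (exists v, ~ N' v).
  have [|g [gN g_neq0]] := IHn (fun i => e (lift ord0 i)) N' N'_sub N'_proper.
    move=> v; have [u [c [Nu ->]]] := eV v.
    exists (u + c 0 ord0 *: e0), (\row_i c 0 (lift ord0 i)).
    split; first by exists u, (c 0 ord0).
    rewrite -addrA !combE big_ord_recl; congr (_ + (_ + _)).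
    by apply: eq_bigr => i _; rewrite mxE.
  exists g; split=> // v Nv; apply: gN; exists v, 0.
  by rewrite scale0r addr0.
have [U [j [j_inj jN]]] := submodule_module N_sub.
have ae_lin : linear (fun a : R^o => a *: e0).
  by move=> b x y; rewrite scalerDl scalerA.
have q_surj : surjective_map (copair j (mklin ae_lin)).
  move=> v; have [u [a [/jN[x <-] ->]]] : N' v.
    by apply: contrapT => N'v; apply: N'_full; exists v.
  by exists (x, a).
have [|g gP] := factor_surjective (f := residue_lin res \o snd) q_surj.
  case=> u a /= e_a; apply/eqP; apply: contraT => ra.
  (* If a were a unit, e0 would lie in N and N would not be proper. *)
  have [b ba] := residue_unit res_surj R_local ra; have [v []] := N_proper.
  have Ne0 : N e0.
    rewrite -[e0]scale1r -ba -scalerA -[a *: e0](addKr (j u)) e_a addr0.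
    by apply/NZ; rewrite -scaleN1r; apply/NZ/jN; exists u.
  have [w [c [Nw ->]]] : N' v.
    by apply: contrapT => N'v; apply: N'_full; exists v.
  by apply: ND => //; apply: NZ.
exists g; split=> [v /jN[u <-]|].
  have := gP (u, 0); rewrite /= scale0r addr0 => ->; exact: rmorph0.
exists e0; have := gP (0, 1); rewrite /= linear0 scale1r add0r => ->.
by rewrite rmorph1; apply/eqP/oner_neq0.
Qed.

(** Vectors dual to a basis of Hom(V, k) generate V. *)
Lemma dual_vectors_generate V d (e : 'I_d -> {linear V -> kmod res})
    (y : 'I_d -> V) :
  fingen V ->
  (forall f : {linear V -> kmod res}, exists c : 'I_d -> k,
     forall x, (f x : k) = \sum_(i < d) c i * (e i x : k)) ->
  (forall i j, (e i (y j) : k) = (i == j)%:R) ->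
  spans y setT.
Proof.
move=> V_fg e_spans ey; apply/generated_comb.
apply: contrapT => y_nsurj.
have [||g [gy [v]]] :=
  @nakayama_functional V [set v | exists c, comb y c = v]%classic V_fg.
- split=> [|_ _ [b <-] [c <-]|a _ [c <-]]; first by exists 0; apply: linear0.
    by exists (b + c); rewrite linearD.
  by exists (a *: c); rewrite linearZ.
- apply: contrapT => y_surj; apply: y_nsurj => v.
  by apply: contrapT => yv; apply: y_surj; exists v.
case; have [c cP] := e_spans g; rewrite [LHS]cP big1 // => i _.
suff -> : c i = 0 by rewrite mul0r.
have := cP (y i); rewrite (bigD1 i) //= ey eqxx mulr1 big1 => [|j /negbTE ji].
  by rewrite addr0 => <-; apply: gy; exists (delta_mx 0 i); rewrite comb_delta.
by rewrite ey ji mulr0.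
Qed.

Lemma hom_subspaceT V : @hom_subspace R k res V setT.
Proof. by []. Qed.

(** mu(V) is the dimension of Hom(V, k). *)
Lemma mu_has_dim V d :
  fingen V -> has_dim (@setT {linear V -> kmod res}) d -> mu V = d.
Proof.
move=> V_fg Vd; have [e [e_ind eP]] := Vd.
have e_spans f := (eP f).1 I.
have [y ey] := dual_vectors res_surj V_fg e_ind.
have d_gen : generated_by V d.
  by exists y; apply: dual_vectors_generate e_spans ey.
have d_min m : generated_by V m -> (d <= m)%N.
  move=> [g /generated_comb g_surj].
  have /eqP <- := independent_row_free g_surj e_ind; exact: rank_leq_col.
apply: xget_unique => // m [m_gen m_min].
by apply/eqP; rewrite eqn_leq m_min //= d_min.
Qed.

(** A functional is stably zero iff it lifts to a map to R. *)
Lemma stable_zero_functional X (g : {linear X -> kmod res}) :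
  Omega_zero 0 g <-> exists h : {linear X -> R^o}, forall x, g x = res (h x).
Proof.
rewrite Omega_zero0; split=> [[P [u [v [P_fgp uv]]]]|[h hP]].
  have [w wP] := P_fgp.2 _ _ (residue_lin res) v res_surj.
  by exists (w \o u) => x; rewrite uv -wP.
exists R^o, h, (residue_lin res); split=> //; exact: fgp_regular.
Qed.

Lemma fingen_kmod : fingen (kmod res).
Proof.
exact: (fingen_surj (f := residue_lin res) res_surj (fgp_regular R).1).
Qed.

(** V (x) k is k^d, where the coordinates of x (x) y are given by a basis of
Hom(V, k). *)
Lemma tensor_residue V : fingen V ->
  exists d (e : 'I_d -> {linear V -> kmod res}),
    @is_tensor R V (kmod res) {ffun 'I_d -> kmod res}
      (fun x y => [ffun i => ((e i x : k) * (y : k) : kmod res)]).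
Proof.
move=> V_fg.
have [d [e [e_ind eP]]] := has_dim_exists res_surj V_fg (hom_subspaceT V).
have [y ey] := dual_vectors res_surj V_fg e_ind.
have y_gen := dual_vectors_generate V_fg (fun f => (eP f).1 I) ey.
exists d, e; split.
  split=> [r x x' z|r x z z']; apply/ffunP => i; rewrite !ffunE.
    rewrite linearD linearZ [LHS]mulrDl; congr (_ + _); exact/esym/mulrA.
  by rewrite [LHS]mulrDr; congr (_ + _); apply: mulrCA.
move=> W b [bl br].
have bl0 z : b 0 z = 0.
  have := bl 1 0 0 z; rewrite !scale1r addr0 => e0.
  by apply: (addIr (b 0 z)); rewrite add0r -e0.
have bsum n (c : 'I_n -> R) (g : 'I_n -> V) z :
    b (\sum_i c i *: g i) z = \sum_i c i *: b (g i) z.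
  elim: n => [|n IHn] in c g *; first by rewrite !big_ord0.
  by rewrite !big_ord_recl bl IHn.
have br0 x : b x 0 = 0.
  have := br 1 x 0 0; rewrite !scale1r addr0 => e0.
  by apply: (addIr (b x 0)); rewrite add0r -e0.
have brZ r x z : b x (r *: z) = r *: b x z.
  by have := br r x z 0; rewrite !addr0 br0 addr0.
split; last first.
  move=> h h' hb h'b z.
  have -> : z = \sum_j [ffun i => ((e i (y j) : k) * (z j : k) : kmod res)].
    apply/ffunP => i; rewrite sum_ffunE (bigD1 i) //= ffunE ey eqxx mul1r.
    rewrite big1 ?addr0 // => j /negbTE; rewrite eq_sym ffunE ey => ->.
    exact: mul0r.
  by rewrite !linear_sum; apply: eq_bigr => j _; rewrite hb h'b.
have h_lin : linear (fun z : {ffun 'I_d -> kmod res} => \sum_j b (y j) (z j)).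
  move=> a z z'; rewrite scaler_sumr -big_split /=; apply: eq_bigr => j _.
  by rewrite !ffunE br.
exists (mklin h_lin) => x z /=; have [c ->] := (y_gen x).1 I.
rewrite bsum; apply: eq_bigr => j _; rewrite ffunE -brZ; congr (b _ _).
rewrite -[LHS]/((e j (\sum_i c i *: y i) : k) * z).
rewrite -[RHS]/(res (c j) * z); congr (_ * _).
rewrite linear_sum (bigD1 j) //= linearZ /= big1 ?addr0 => [|i /negbTE ij].
  by rewrite -[LHS]/(res (c j) * (e j (y j) : k)) ey eqxx mulr1.
rewrite linearZ; rewrite -[LHS]/(res (c i) * (e j (y i) : k)).
by rewrite ey eq_sym ij mulr0.
Qed.

(** f (x) k = 0 iff every functional on the target vanishes on the image. *)
Lemma tensor_map_zeroP V M (f : {linear M -> V}) : fingen V -> fingen M ->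
  tensor_map_zero f (kmod res) <->
  forall g : {linear V -> kmod res}, forall x, g (f x) = 0.
Proof.
move=> V_fg M_fg; split=> [[S [T [s [t [F [_ [_ tU] Fst F0]]]]]] g x|gf0].
  have [|[h hP] _] := tU _ (fun z y => ((g z : k) * (y : k) : kmod res)).
    split=> [r z z' y|r z y y'].
      by rewrite linearD linearZ [LHS]mulrDl; congr (_ + _); apply/esym/mulrA.
    by rewrite [LHS]mulrDr; congr (_ + _); apply: mulrCA.
  have := hP (f x) 1; rewrite -Fst F0 linear0 => ->; exact/esym/mulr1.
have [d [e eT]] := tensor_residue M_fg.
have [d' [e' e'T]] := tensor_residue V_fg.
exists {ffun 'I_d -> kmod res}, {ffun 'I_d' -> kmod res}.
eexists; eexists; exists \0; split; [exact: eT|exact: e'T| |by []].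
by move=> x y; apply/ffunP => i; rewrite !ffunE gf0; apply/esym/mul0r.
Qed.

End LocalRing.

(** * The approximated xi-invariants *)

Section Invariant.
Variables (R : comNzRingType) (k : fieldType) (res : {rmorphism R -> k}).
Hypothesis R_noeth : noetherian R.
Hypothesis R_local : local_ring R.
Hypothesis res_surj : residue_map res.
Implicit Types X Y Z F W M N P : lmodType R.

Lemma xi_kernel_subspace n M :
  fingen M -> hom_subspace (@xi_kernel R k res n M).
Proof.
move=> M_fg; have k_fg := fingen_kmod res_surj.
split=> [f g fg|  |f g|a f].
- exact: Omega_zero_eq.
- apply: Omega_zero_stable => //; apply/Omega_zero0.
  by exists 'rV[R]_0, \0, \0; split=> //; apply: fgp_free.
- exact: Omega_zeroD.
- exact: Omega_zeroZ.
Qed.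

Lemma xi_dim n M : fingen M -> has_dim (@xi_kernel R k res n M) (xi res n M).
Proof.
move=> M_fg.
have [d Wd] := has_dim_exists res_surj M_fg (xi_kernel_subspace n M_fg).
by rewrite (xi_has_dim Wd).
Qed.

(** Maps X -> R whose reductions have dual vectors split off a free summand. *)
Lemma free_summand_lift X d (h : 'I_d -> {linear X -> R^o})
    (x : 'I_d -> X) :
  (forall i j, res (h i (x j)) = (i == j)%:R) -> has_free_summand X d.
Proof.
move=> hx.
have eta_lin : linear (fun y => \row_i h i y : 'rV[R]_d).
  by move=> a y z; apply/rowP => i; rewrite !mxE linearP.
pose eta : {linear X -> 'rV[R]_d} := mklin eta_lin.
pose G : 'M[R]_d := \matrix_(j, i) h i (x j).
have etaG c : eta (comb x c) = c *m G.
  rewrite combE linear_sum; apply/rowP => i; rewrite summxE !mxE.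
  by apply: eq_bigr => j _; rewrite linearZ !mxE.
(* The determinant of G is a unit: G is the identity modulo the maximal ideal. *)
have : res (\det G) != 0.
  suff -> : res (\det G) = 1 by apply: oner_neq0.
  rewrite -det_map_mx -(det1 k d); congr (\det _); apply/matrixP => i j.
  by rewrite !mxE hx eq_sym.
move=> /(residue_unit res_surj R_local)[b bG].
have sigma_lin : linear (fun c => comb x (c *m (b *: \adj G))).
  by move=> a y z; rewrite mulmxDl -scalemxAl linearP.
pose sigma : {linear 'rV[R]_d -> X} := mklin sigma_lin.
have eta_sigma c : eta (sigma c) = c.
  rewrite [LHS]etaG -mulmxA -scalemxAl mul_adj_mx scale_scalar_mx bG.
  exact: mulmx1.
have [X' [j [j_inj j_exact]]] := kernel_module eta.
exists X', (copair sigma j); split.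
  have eta_copair z : eta (copair sigma j z) = z.1.
    by rewrite [copair _ _ _]/= linearD (exact_comp0 _ j_exact) addr0 eta_sigma.
  move=> [c u] [c' u'] e; have cc' := congr1 eta e.
  rewrite !eta_copair /= in cc'; rewrite cc' in e *; congr (_, _).
  by apply/j_inj/(addrI (sigma c')).
move=> y; have /j_exact[u ju] : eta (y - sigma (eta y)) = 0.
  by rewrite linearB eta_sigma subrr.
by exists (eta y, u); rewrite [LHS]/= ju addrC subrK.
Qed.

(** The rank of the largest free summand of X is the dimension of the space
of stably zero functionals on X. *)
Lemma max_free_rank_stable X d : fingen X ->
  has_dim (fun g : {linear X -> kmod res} => Omega_zero 0 g) d ->
  max_free_rank X = d.
Proof.
move=> X_fg Sd.
have d_max s : has_free_summand X s -> (s <= d)%N.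
  move=> [X' [f [f_inj f_surj]]].
  have [t ft] := factor_injective (f := idfun) f_inj f_surj.
  have tf z : t (f z) = z by apply/f_inj/ft.
  have c_lin (i : 'I_s) : linear (fun x => (t x).1 0 i : R^o).
    by move=> a x y; rewrite !linearP !mxE.
  pose c i : {linear X -> kmod res} := residue_lin res \o mklin (c_lin i).
  apply: (has_dim_bound (f := c) Sd) => [i|].
    by apply/(stable_zero_functional res_surj); exists (mklin (c_lin i)).
  apply: (dual_independent (y := fun j => f (delta_mx 0 j, 0))) => i j.
  by rewrite /= tf mxE eqxx /= rmorph_nat.
have [e [e_ind eP]] := Sd.
have d_free : has_free_summand X d.
  have [x ex] := dual_vectors res_surj X_fg e_ind.
  have /choice[h hP] i := (stable_zero_functional res_surj (e i)).1
                            (has_dim_basis i eP).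
  by apply: (free_summand_lift (h := h) (x := x)) => i j; rewrite -hP.
apply: xget_unique => // s [s_free s_max].
by apply/eqP; rewrite eqn_leq d_max //= s_max.
Qed.

(** In a minimal approximation no functional that lifts to R is nonzero on Y:
otherwise some element of Y would span a free summand of X. *)
Lemma minimal_AB_stable_zero n Y X M (i : {linear Y -> X})
    (p : {linear X -> M}) (h : {linear X -> R^o}) y :
  is_minimal_AB_approx n i p -> res (h (i y)) = 0.
Proof.
move=> [_ i_min]; apply/eqP; apply: contraT => hy_neq0.
have [b bh] := residue_unit res_surj R_local hy_neq0.
pose X0 : set X := fun x => exists c, x = c *: i y.
pose X1 : set X := fun x => h x = 0.
have X01 : internal_direct_sum X0 X1.
  split.
  - split=> [|_ _ [c ->] [d ->]|a _ [c ->]].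
    + by exists 0; rewrite scale0r.
    + by exists (c + d); rewrite scalerDl.
    + by exists (a * c); rewrite scalerA.
  - split=> [|x z hx hz|a x hx]; rewrite /X1 ?linear0 //.
      by rewrite linearD hx hz addr0.
    by rewrite linearZ hx; apply: scaler0.
  - move=> x; exists (h x * b *: i y), (x - h x * b *: i y).
    split; [by exists (h x * b)| |by rewrite addrC subrK].
    rewrite /X1 linearB linearZ -[X in _ - X]/(h x * b * h (i y)).
    by rewrite -mulrA bh mulr1 subrr.
  - move=> _ [c ->] hc; suff -> : c = 0 by rewrite scale0r.
    rewrite -[c]mulr1 -bh mulrCA; suff -> : c * h (i y) = 0 by rewrite mulr0.
    by rewrite -[RHS]hc linearZ.
have X0i : (X0 `<=` range i)%classic.
  by move=> _ [c ->]; exists (c *: y) => //; rewrite linearZ.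
have /seteqP[/(_ (i y)) h0 _] := i_min X0 X1 X01 X0i.
move: hy_neq0; rewrite h0 ?linear0 ?rmorph0 ?eqxx //.
by exists 1; rewrite scale1r.
Qed.

Lemma xi_AB_approx n Y X M (i : {linear Y -> X}) (p : {linear X -> M}) :
  is_minimal_AB_approx n i p -> xi res n M = max_free_rank X.
Proof.
move=> min_ip; have [[Y_fg X_fg ip Y_pd XR] _] := min_ip.
have [_ ip_exact p_surj] := ip; have M_fg := fingen_surj p_surj X_fg.
have k_fg := fingen_kmod res_surj.
have stable_p (f : {linear M -> kmod res}) :
    xi_kernel n f <-> Omega_zero 0 (f \o p).
  split=> [fz|fpz].
    by apply: (Omega_zero_Ext R_noeth X_fg k_fg XR); apply: Omega_zero_precomp.
  apply: (Omega_zero_descend R_noeth X_fg k_fg ip Y_pd).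
  exact: Omega_zero_stable.
have [e [e_ind eP]] := xi_dim n M_fg.
apply/esym/max_free_rank_stable => //; exists (fun j => e j \o p); split.
  by move=> c c0; apply: e_ind => x; have [z <-] := p_surj x; apply: c0.
move=> g; split=> [gz|[c cP]].
  (* A stably zero functional vanishes on Y, hence comes from M. *)
  have [h hP] := (stable_zero_functional res_surj g).1 gz.
  have [|f fP] := factor_surjective (f := g) p_surj.
    move=> _ /ip_exact[y <-]; rewrite hP; exact: minimal_AB_stable_zero min_ip.
  have /eP[c cP] : xi_kernel n f.
    by apply/stable_p; apply: Omega_zero_eq gz => x; rewrite -fP.
  by exists c => x; rewrite -fP cP.
have [|f fP] := factor_surjective (f := g) p_surj.
  move=> x px; rewrite [LHS]cP big1 // => j _.
  by rewrite /= px linear0; apply: mulr0.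
apply: (@Omega_zero_eq _ 0 _ _ (f \o p)) => //.
apply/stable_p/eP; exists c => x; have [z <-] := p_surj x.
by rewrite fP cP.
Qed.

(** The middle term of an extension of a module of projective dimension at
most n by a projective module has projective dimension at most n. *)
Lemma pd_le_extension (n : nat) F Z Y (j : {linear F -> Z})
    (q : {linear Z -> Y}) :
  fg_projective F -> short_exact j q -> pd_le n Y -> pd_le n Z.
Proof.
move=> F_fgp [j_inj jq q_surj] /pd_le_syzygy[K [P [i [p [P_fgp ip K_pd]]]]].
have [i_inj ip_exact p_surj] := ip.
have [s sP] := P_fgp.2 _ _ q p q_surj.
have [|t tP] := factor_injective (f := s \o i) j_inj.
  by move=> x; apply/jq; rewrite [LHS]sP (exact_comp0 _ ip_exact).
apply: (@pd_le_extend _ n K (P * F)%type Z (pairing i (\- t)) (copair s j))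
  K_pd.
  exact: fgp_prod.
split.
- by move=> x y [] /i_inj.
- move=> [a b]; split=> [/= e|[x [<- <-]]]; last first.
    by rewrite /= linearN /= tP /= subrr.
  have /ip_exact[x ix] : p a = 0.
    have := congr1 q e; rewrite linearD sP linear0.
    by rewrite (exact_comp0 _ jq) addr0.
  exists x; congr (_, _) => //=; apply: j_inj.
  by rewrite linearN tP /= ix; apply/eqP; rewrite eq_sym -addr_eq0 addrC e.
- move=> z; have [a pa] := p_surj (q z).
  have /jq[b jb] : q (z - s a) = 0 by rewrite linearB sP /= pa subrr.
  by exists (a, b); rewrite /= jb addrC subrK.
Qed.

(** The pushout of 0 -> X -> W -> Y -> 0 along X -> F. *)
Lemma pushout_extension X W Y F (i : {linear X -> W}) (p : {linear W -> Y})
    (u : {linear X -> F}) :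
  short_exact i p ->
  exists Z (j : {linear F -> Z}) (w : {linear W -> Z}) (q : {linear Z -> Y}),
    [/\ short_exact j q, forall x, w (i x) = j (u x),
        forall z, exists a b, z = j a + w b
      & forall a b, j a + w b = 0 <-> exists x, a = - u x /\ b = i x].
Proof.
move=> [i_inj ip p_surj].
pose N : set (F * W)%type := fun z => exists x, z.1 = - u x /\ z.2 = i x.
have N_sub : submodule N.
  split=> [|[a b] [c d] [x [/= -> ->]] [y [/= -> ->]]|r [a b] [x [/= -> ->]]].
  - by exists 0; rewrite !linear0.
  - by exists (x + y); rewrite !linearD.
  - by exists (r *: x); rewrite !linearZ.
have [Z [c [c_surj cN]]] := quotient_module N_sub.
have cE a b : c (a, b) = c (a, 0) + c (0, b).
  rewrite -linearD; congr (c _).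
  by apply/eqP; rewrite -pair_eqE /pair_eq /= addr0 add0r !eqxx.
have [|q qP] := factor_surjective (f := p \o snd) c_surj.
  by move=> z /cN[x [_ /= ->]]; apply: exact_comp0 ip.
pose j : {linear F -> Z} := c \o pairing idfun \0.
pose w : {linear W -> Z} := c \o pairing \0 idfun.
have jw a b : j a + w b = 0 <-> exists x, a = - u x /\ b = i x.
  by rewrite -[j a + w b]cE cN.
have wi x : w (i x) = j (u x).
  apply/esym/eqP; rewrite -subr_eq0 -linearN; apply/eqP/jw.
  by exists (- x); rewrite !linearN opprK.
have qj a : q (j a) = 0 by rewrite qP /= linear0.
have qw b : q (w b) = p b by rewrite qP.
have jw_surj z : exists a b, z = j a + w b.
  by have [[a b] <-] := c_surj z; exists a, b; apply: cE.
exists Z, j, w, q; split=> //; split=> [a b ab|z|y].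
- have /jw[x [e /esym/eqP]] : j (a - b) + w 0 = 0.
    by rewrite linear0 addr0 linearB ab subrr.
  rewrite -[0](linear0 i) => /eqP/i_inj x0.
  by apply/eqP; rewrite -subr_eq0 e x0 linear0 oppr0.
- split=> [|[a <-]]; last exact: qj.
  have [a [b ->]] := jw_surj z; rewrite linearD qj add0r qw => /ip[x <-].
  by exists (a + u x); rewrite linearD wi.
- by have [b <-] := p_surj y; exists (w b).
Qed.

Lemma xi_origin_extension n M : in_E n M -> fingen M ->
  xi res n M = 0%N <->
  forall Z (f : {linear M -> Z}),
    fingen Z -> pd_le n Z -> tensor_map_zero f (kmod res).
Proof.
move=> [X [P [Y [i [p [[X_fg Y_fg] P_fgp ip Y_pd XR]]]]]] M_fg.
have k_fg := fingen_kmod res_surj.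
have [e [e_ind eP]] := xi_dim n M_fg.
split=> [xi0 Z f Z_fg Z_pd|pd_zero].
  apply/(tensor_map_zeroP R_local res_surj f Z_fg M_fg) => g x.
  have /eP[c cP] : xi_kernel n (g \o f).
    apply: Omega_zero_precomp => //; exact: Omega_zero_pd.
  rewrite -[LHS]/((g \o f) x : k) cP.
  by move: c e {e_ind eP cP}; rewrite xi0 => c e; apply: big_ord0.
apply/eqP; rewrite -leqn0 leqNgt; apply/negP => xi_gt0.
(* A basis functional f factors through a module of projective dimension at
   most n, hence vanishes. *)
pose f := e (Ordinal xi_gt0).
have [x] := independent_neq0 (Ordinal xi_gt0) e_ind; apply.
rewrite -/f.
have fz : Omega_zero n f := has_dim_basis (Ordinal xi_gt0) eP.
have /Omega_zero0[F [u [v [F_fgp uv]]]] : Omega_zero 0 (f \o (fst \o i)).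
  apply: (Omega_zero_Ext R_noeth X_fg k_fg XR); exact: Omega_zero_precomp.
have [Z [j [w [q [jq wi jw_surj jw]]]]] := pushout_extension u ip.
have Z_pd := pd_le_extension F_fgp jq Y_pd.
have q_surj : surjective_map (copair j w).
  by move=> z; have [a [b ->]] := jw_surj z; exists (a, b).
have Z_fg : fingen Z.
  apply: fingen_surj q_surj _; apply: fingen_prod (fingen_prod M_fg P_fgp.1).
  exact: F_fgp.1.
have [|g gP] := factor_surjective (f := copair v (f \o fst)) q_surj.
  by move=> [a b] /= /jw[t [-> ->]]; rewrite /= linearN -uv; apply: addNr.
have f_factor y : f y = g (w (y, 0)).
  have := gP (0, (y, 0)); rewrite /= linear0 add0r => ->.
  by rewrite linear0 add0r.
rewrite f_factor.
have /(tensor_map_zeroP R_local res_surj _ Z_fg M_fg) :=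
  pd_zero Z (w \o pairing idfun \0) Z_fg Z_pd.
exact.
Qed.

(** A functional on M is in the kernel iff it extends to an FPD hull of M. *)
Lemma xi_kernel_FPD_hull n M Y X (i : {linear M -> Y}) (p : {linear Y -> X})
    (f : {linear M -> kmod res}) :
  is_FPD_hull n i p ->
  xi_kernel n f <-> exists g : {linear Y -> kmod res}, forall x, g (i x) = f x.
Proof.
move=> [Y_fg X_fg ip Y_pd XR]; have [i_inj ip_exact p_surj] := ip.
have M_fg := fingen_kernel R_noeth ip Y_fg; have k_fg := fingen_kmod res_surj.
split=> [fz|[g gP]]; last first.
  apply: (@Omega_zero_eq _ n _ _ (g \o i)) => //.
  by apply: Omega_zero_precomp => //; apply: Omega_zero_pd.
have [m [K [l [c lc]]]] := free_cover X_fg.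
have K_fg := fingen_kernel R_noeth lc (@fingen_free R m).
have [_ lc_exact c_surj] := lc.
have [s ps] := (@projective_free R m) _ _ p c p_surj.
have [|a aP] := factor_injective (f := s \o l) i_inj.
  by move=> x; apply/ip_exact; rewrite [LHS]ps (exact_comp0 _ lc_exact).
have /Omega_zero0[F [u [v [F_fgp uv]]]] : Omega_zero 0 (f \o a).
  have KR t : (1 <= t <= n)%N -> Ext_zero t K R^o.
    case: t => // t tn; apply: Ext_zero_syzygy (@fgp_free R m) lc _.
    exact: XR.
  apply: (Omega_zero_Ext R_noeth K_fg k_fg KR); exact: Omega_zero_precomp.
have [u' u'P] :=
  Ext1_zero_lift_fgp R_noeth (@fgp_free R m) lc (XR 1%N isT) F_fgp u.
(* Y is the quotient of M x R^m by the elements (- a x, l x), x in K. *)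
have q_surj : surjective_map (copair i s).
  move=> y; have [d cd] := c_surj (p y).
  have /ip_exact[x ix] : p (y - s d) = 0 by rewrite linearB /= ps cd subrr.
  by exists (x, d); rewrite /= ix subrK.
have [|g gP] := factor_surjective (f := copair f (v \o u')) q_surj.
  move=> [x d] /= e; have /lc_exact[z lz] : c d = 0.
    have := congr1 p e; rewrite linearD ps linear0.
    by rewrite (exact_comp0 _ ip_exact) add0r.
  have -> : x = - a z.
    apply: i_inj; rewrite linearN aP /= lz; apply/eqP.
    by rewrite -addr_eq0 e.
  by rewrite linearN -lz u'P -uv addNr.
exists g => x; have := gP (x, 0); rewrite /= !linear0 !addr0; exact.
Qed.

(** Exactness of 0 -> Hom(X, k) -> Hom(Y, k) -> Hom(M, k), in dimensions. *)
Lemma hom_dim_exact M Y X (i : {linear M -> Y}) (p : {linear Y -> X})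
    (S : set {linear M -> kmod res}) r s :
  short_exact i p ->
  (forall f : {linear M -> kmod res},
     S f <-> exists g : {linear Y -> kmod res}, forall x, g (i x) = f x) ->
  has_dim S r -> has_dim (@setT {linear X -> kmod res}) s ->
  has_dim (@setT {linear Y -> kmod res}) (s + r).
Proof.
move=> [i_inj ip p_surj] SP [b [b_ind bP]] [a [a_ind aP]].
have /choice[b' b'P] j := (SP (b j)).1 (has_dim_basis j bP).
pose e t : {linear Y -> kmod res} :=
  match split t with inl j => a j \o p | inr j => b' j end.
have el j y : e (lshift r j) y = a j (p y) by rewrite /e (unsplitK (inl j)).
have er j y : e (rshift s j) y = b' j y by rewrite /e (unsplitK (inr j)).
have eE c y : \sum_t c t * (e t y : k) =
    \sum_j c (lshift r j) * (a j (p y) : k)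
    + \sum_j c (rshift s j) * (b' j y : k).
  rewrite big_split_ord; congr (_ + _); apply: eq_bigr => j _.
    by rewrite el.
  by rewrite er.
exists e; split=> [c c0|f].
  have cr j : c (rshift s j) = 0.
    apply: (b_ind (fun j => c (rshift s j))) => x.
    rewrite -[RHS](c0 (i x)) eE [X in _ = X + _]big1 => [|l _]; last first.
      by rewrite (exact_comp0 _ ip) linear0; apply: mulr0.
    by rewrite add0r; apply: eq_bigr => l _; rewrite b'P.
  have cl j : c (lshift r j) = 0.
    apply: (a_ind (fun j => c (lshift r j))) => x; have [y <-] := p_surj x.
    rewrite -[RHS](c0 y) eE [X in _ = _ + X]big1 ?addr0 // => l _.
    by rewrite cr mul0r.
  by move=> t; rewrite -[t]splitK; case: (split t) => j; [apply: cl|apply: cr].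
split=> // _.
have /bP[c cP] : S (f \o i) by apply/SP; exists f.
have /choice[g gP] j := res_surj (c j).
pose B y : kmod res := \sum_j g j *: b' j y.
have B_lin : linear (fun y => f y - B y).
  move=> x y z; rewrite linearP scalerBr addrACA -opprD; congr (_ - _).
  rewrite scaler_sumr -big_split; apply: eq_bigr => j _ /=.
  by rewrite linearP scalerDr !scalerA mulrC.
have BE y : (B y : k) = \sum_j c j * (b' j y : k).
  by apply: eq_bigr => j _; rewrite -gP.
have [|h hP] := factor_surjective (f := mklin B_lin) p_surj.
  move=> _ /ip[x <-] /=; apply/eqP; rewrite subr_eq0; apply/eqP.
  rewrite -[LHS]/((f \o i) x) [LHS]cP [RHS]BE.
  by apply: eq_bigr => j _; rewrite b'P.
have [d dP] := (aP h).1 I.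
exists (fun t => match split t with inl j => d j | inr j => c j end) => y.
rewrite eE; transitivity ((h (p y) : k) + (B y : k)).
  by rewrite hP; apply/esym/subrK.
rewrite dP BE; congr (_ + _); apply: eq_bigr => j _.
  by rewrite (unsplitK (inl j)).
by rewrite (unsplitK (inr j)).
Qed.

Lemma xi_FPD_hull n M Y X (i : {linear M -> Y}) (p : {linear Y -> X}) :
  is_FPD_hull n i p -> mu Y = (mu X + xi res n M)%N.
Proof.
move=> hull; have [Y_fg X_fg ip _ _] := hull.
have M_fg := fingen_kernel R_noeth ip Y_fg.
have [s Xs] := has_dim_exists res_surj X_fg (@hom_subspaceT R k res X).
rewrite (mu_has_dim R_local res_surj X_fg Xs).
apply: (mu_has_dim R_local res_surj Y_fg).
apply: hom_dim_exact ip _ (xi_dim n M_fg) Xs => f.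
exact: xi_kernel_FPD_hull hull.
Qed.

End Invariant.

Theorem theorem1p4 (R : comNzRingType) (k : fieldType)
    (res : {rmorphism R -> k}) (M : lmodType R) (n : nat)
    (R_noetherian : noetherian R) (R_local : local_ring R)
    (res_residue : residue_map res) (M_fg : fingen M) :
  [/\ in_A n M ->
      forall (Y X : lmodType R) (i : {linear Y -> X}) (p : {linear X -> M}),
        is_minimal_AB_approx n i p -> xi res n M = max_free_rank X,
      in_E n M ->
        (xi res n M = 0%N <->
         forall (Z : lmodType R) (f : {linear M -> Z}),
           fingen Z -> pd_le n%:Z Z -> tensor_map_zero f (kmod res))
    & in_H n M ->
      forall (Y X : lmodType R) (i : {linear M -> Y}) (p : {linear Y -> X}),
        is_FPD_hull n i p ->
        (xi res n M)%:Z = (mu Y)%:Z - (mu X)%:Z].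
Proof.
split=> [_ Y X i p| |_ Y X i p hull].
- exact: xi_AB_approx.
- by move=> ME; apply: xi_origin_extension.
rewrite (xi_FPD_hull R_noetherian R_local res_residue hull).
by rewrite PoszD addrC addKr.
Qed.
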